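(* Let $A,B\in\mathbb{R}^{m\times n}$ be two random matrices with independent entries and matching first two moments, i.e. $\mathbb{E}A_{ij}^\ell=\mathbb{E}B_{ij}^\ell$ for all $i\in[m],j\in[n],\ell=1,2$. Let $Q:\mathbb{R}^m\times\mathbb{R}^n\to\mathbb{R}$ be measurable and $X(u,w;A)\equiv u^\top Aw+Q(u,w)$. There exists a universal constant $C_0>0$ such that for any measurable subsets $\mathcal{S}_u\subset[-L_u,L_u]^m$, $\mathcal{S}_w\subset[-L_w,L_w]^n$ with $L_u,L_w\ge1$, and any $\mathsf g\in C^3(\mathbb{R})$, $$\Big|\mathbb{E}\,\mathsf g\Big(\max_{u\in\mathcal{S}_u}\min_{w\in\mathcal{S}_w}X(u,w;A)\Big)-\mathbb{E}\,\mathsf g\Big(\max_{u\in\mathcal{S}_u}\min_{w\in\mathcal{S}_w}X(u,w;B)\Big)\Big|$$ $$\le C_0K_{\mathsf g}\inf_{\delta\in(0,1)}\Big\{M_1L\delta+\mathscr M_Q(L,\delta)+\log_+^{2/3}(L/\delta)\,(m+n)^{2/3}M_3^{1/3}L^2\Big\}.$$ Here $K_{\mathsf g}\equiv1+\max_{\ell\in\{0,1,2,3\}}\lVert\mathsf g^{(\ell)}\rVert_\infty$, $L\equiv L_u+L_w$, $M_\ell\equiv\sum_{i\in[m],j\in[n]}(\mathbb{E}|A_{ij}|^\ell+\mathbb{E}|B_{ij}|^\ell)$, and $\mathscr M_Q(L,\delta)\equiv\sup|Q(u,w)-Q(u',w')|$, with the supremum over all $u,u'\in[-L,L]^m$, $w,w'\in[-L,L]^n$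 such that $\lVert u-u'\rVert_\infty\vee\lVert w-w'\rVert_\infty\le\delta$. The conclusion continues to hold when max-min is flipped to min-max.
   Context: Notation: $[m]=\{1,\dots,m\}$; $a\vee b=\max\{a,b\}$; $\log_+(a)=1\vee\log a$ for $a>0$; $\lVert\cdot\rVert_\infty$ is the sup norm of functions or vectors. *)

(* Defs.v *)
From HB Require Import structures.
From mathcomp Require Export all_boot all_order all_algebra.
From mathcomp Require Export all_classical all_reals all_analysis.
Set Implicit Arguments.
Unset Strict Implicit.
Unset Printing Implicit Defensive.
Export Order.TTheory GRing.Theory Num.Theory.
Export numFieldNormedType.Exports.
Local Open Scope classical_set_scope.
Local Open Scope ring_scope.

(* MathComp-Analysis gives column vectors a topology but no measurable
   structure: equip a topological space with its Borel sigma-algebra. *)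
Definition borel (T : ptopologicalType) := g_sigma_algebraType (@open T).

(* Mutual independence of a finite family of real random variables; the
   product rule for subfamilies is the case where some B i are [set: R]. *)
Definition independent_family (R : realType) (d : measure_display)
    (T : measurableType d) (P : probability T R) (I : finType)
    (X : I -> {RV P >-> R}) : Prop :=
  forall B : I -> set R, (forall i, measurable (B i)) ->
    P (\bigcap_i (X i @^-1` B i)) = (\prod_(i : I) P (X i @^-1` B i))%E.

Definition random_matrix (R : realType) (d : measure_display)
    (T : measurableType d) (P : probability T R) (m n : nat)
    (A : 'I_m -> 'I_n -> {RV P >-> R}) (t : T) : 'M[R]_(m, n) :=
  \matrix_(i, j) A i j t.

Definition C3 (R : realType) (g : R -> R) : Prop :=
  (forall (l : nat) (x : R), (l < 3)%N -> derivable (derive1n l g) x 1) /\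
  continuous (derive1n 3 g).

Section Quantities.
Local Open Scope ereal_scope.

Definition sup_norm (R : realType) (f : R -> R) : \bar R :=
  ereal_sup [set `|f x|%:E | x in [set: R]].

(* +oo when g or one of its first three derivatives is unbounded *)
Definition Kg (R : realType) (g : R -> R) : \bar R :=
  1 + \big[maxe/0]_(l < 4) sup_norm (derive1n l g).

Definition log_plus (R : realType) (a : R) : R := Num.max 1%R (ln a).

Definition moment_sum (R : realType) (m n : nat)
    (dA dB : measure_display)
    (TA : measurableType dA) (PA : probability TA R)
    (TB : measurableType dB) (PB : probability TB R)
    (A : 'I_m -> 'I_n -> {RV PA >-> R}) (B : 'I_m -> 'I_n -> {RV PB >-> R})
    (l : nat) : \bar R :=
  \sum_(i < m) \sum_(j < n)
    ('E_PA[fun t => (`|A i j t| ^+ l)%R] + 'E_PB[fun t => (`|B i j t| ^+ l)%R]).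

(* `|_| on column vectors is the sup norm, so that `|u| <= L says that u lies
   in the cube [-L, L]^m *)
Definition modulus (R : realType) (m n : nat)
    (Q : 'cV[R]_m -> 'cV[R]_n -> R) (L delta : R) : \bar R :=
  ereal_sup [set x : \bar R | exists u u' w w',
    [/\ (`|u| <= L)%R /\ (`|u'| <= L)%R,
        (`|w| <= L)%R /\ (`|w'| <= L)%R,
        (Num.max `|u - u'| `|w - w'| <= delta)%R &
        x = `|Q u w - Q u' w'|%:E]].

Definition payoff (R : realType) (m n : nat)
    (Q : 'cV[R]_m -> 'cV[R]_n -> R)
    (A : 'M[R]_(m, n)) (u : 'cV[R]_m) (w : 'cV[R]_n) : R :=
  ((u^T *m A *m w) ord0 ord0 + Q u w)%R.

(* Max and min are read as supremum and infimum in \bar R. They are finite for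
   nonempty bounded sets of vectors as soon as Q is bounded on them, which
   holds whenever some modulus Q L delta with delta > 0 is finite; otherwise
   fine sends the infinite values to 0. *)
Definition maxmin (R : realType) (U W : Type) (Su : set U) (Sw : set W)
    (X : U -> W -> R) : R :=
  fine (ereal_sup [set ereal_inf [set (X u w)%:E | w in Sw] | u in Su]).

Definition minmax (R : realType) (U W : Type) (Su : set U) (Sw : set W)
    (X : U -> W -> R) : R :=
  fine (ereal_inf [set ereal_sup [set (X u w)%:E | w in Sw] | u in Su]).

End Quantities.

(* Main.v *)
Require Import Defs.
From mathcomp Require Import measurable_realfun ring lra zify.
Set Implicit Arguments.
Unset Strict Implicit.
Unset Printing Implicit Defensive.
Local Open Scope classical_set_scope.
Local Open Scope ring_scope.

(* Lindeberg replacement applied to a smooth surrogate of the max-min.  On delta-nets of the two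
   sets the max-min is within O((m + n) log(L / delta) / beta) of the soft max-min
   F = beta^-1 log (sum_u (sum_w exp (- beta X(u, w)))^-1), and restricting to the nets costs at
   most L delta times the sum of the |A_ij|, plus the modulus of Q.  In each entry of the matrix, g o F
   has a third derivative of order K_g beta^2 L^6, so replacing the entries one at a time, with
   matching first two moments, costs K_g beta^2 L^6 M_3; balancing in beta gives the bound.

   To replace entries without product measures, the entries are rounded to a finite grid: an
   expectation is then a finite sum with product weights, and the grid is refined by dominated
   convergence.  Since the max-min is Lipschitz in the matrix in any case (as an extended real it
   is finite for every matrix or for none), no measurability of Q or of the sets is involved. *)


(** * Replacement for finite product weights *)

(** The nets have exponentially many points, so the derivatives of [F] must be bounded independently
    of their number. Relative bounds [|y^(k)| <= B_k y] achieve this: sums and inverses preserve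
    bounds of this form, and the logarithm makes them absolute. An entry enters the payoff with
    coefficient [u_i w_j], at most [L^2] in size, hence [L^6] at third order. With
    [N = log_+(L / delta) (m + n)] the smoothing error is of order [N / beta] and the replacement
    error of order [beta^2 L^6 M_3]; both become [N^(2/3) M_3^(1/3) L^2] at
    [beta = N^(1/3) / (M_3^(1/3) L^2)]. The estimate uses [beta >= 1], so that [beta^2] dominates
    the lower powers left by the chain rule; if [beta < 1], this common value is at least 1 and the
    sup bound on [g] suffices. If [M_3 = 0] there is no such [beta], but then all entries vanish
    almost surely. The constant is 43 = 3 + 3 + 37: smoothing for [A] and for [B], and 37 = 1 + 12 +
    24 from the third derivative of [g o F]. Min-max is minus the max-min of the negated payoff,
    tested against [x -> g (- x)]. *)

Definition upd (I : eqType) (T : Type) (x : I -> T) (k : I) (a : T) : I -> T :=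
  fun i => if i == k then a else x i.

Lemma sum_prod_weights (R : comPzSemiRingType) (I Z : finType) (p : I -> Z -> R) :
  (forall i, \sum_z p i z = 1) ->
  \sum_(z : {ffun I -> Z}) \prod_i p i (z i) = 1.
Proof.
by move=> p1; rewrite -(bigA_distr_bigA p) big1// => i _; exact: p1.
Qed.

(** The two product weights differ by [q - p k] at coordinate [k] times the common weight [W] of the
    others. As [p k] sums to 1, an extra variable [a] of law [p k] can be inserted; the involution
    [sw] exchanges it with [z k], which restores the full product weight of [z] and leaves the sum
    over [a] bounded by hypothesis. *)
Lemma finite_swap (R : realFieldType) (I Z : finType) (p : I -> Z -> R)
    (q : Z -> R) (k : I) (h : (I -> Z) -> R) (c : R) :
  (forall i z, 0 <= p i z) -> (forall i, \sum_z p i z = 1) ->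
  (forall z : {ffun I -> Z}, `|\sum_a (q a - p k a) * h (upd z k a)| <= c) ->
  `|\sum_(z : {ffun I -> Z}) (\prod_i (if i == k then q (z i) else p i (z i))) * h z
    - \sum_(z : {ffun I -> Z}) (\prod_i p i (z i)) * h z| <= c.
Proof.
move=> p0 p1 hc.
pose W (z : {ffun I -> Z}) := \prod_(i | i != k) p i (z i).
have -> : \sum_(z : {ffun I -> Z}) (\prod_i (if i == k then q (z i) else p i (z i))) * h z
    - \sum_(z : {ffun I -> Z}) (\prod_i p i (z i)) * h z =
    \sum_(z : {ffun I -> Z}) (q (z k) - p k (z k)) * W z * h z.
  rewrite -sumrB; apply: eq_bigr => z _.
  rewrite -mulrBl; congr (_ * _); rewrite (bigD1 k)//= eqxx [in X in _ - X](bigD1 k)//=.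
  rewrite mulrBl; congr (_ * _ - _); apply: eq_bigr => i /negbTE -> //.
have -> : \sum_(z : {ffun I -> Z}) (q (z k) - p k (z k)) * W z * h z =
    \sum_(z : {ffun I -> Z}) \sum_a p k a * ((q (z k) - p k (z k)) * W z * h z).
  by apply: eq_bigr => z _; rewrite -mulr_suml p1 mul1r.
pose sw (za : {ffun I -> Z} * Z) : {ffun I -> Z} * Z :=
  ([ffun i => if i == k then za.2 else za.1 i], za.1 k).
have swK : involutive sw.
  move=> [z a]; rewrite /sw /= ffunE eqxx; congr (_, _).
  by apply/ffunP => i; rewrite !ffunE; case: eqP => [->|].
rewrite pair_bigA /= (reindex_inj (inv_inj swK)) /=.
rewrite -(pair_bigA _ (fun (z : {ffun I -> Z}) a => p k (z k) *
  ((q ([ffun i => if i == k then a else z i] k) -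
    p k ([ffun i => if i == k then a else z i] k)) *
    W [ffun i => if i == k then a else z i] * h [ffun i => if i == k then a else z i]))) /=.
have -> : c = \sum_(z : {ffun I -> Z}) (\prod_i p i (z i)) * c.
  by rewrite -mulr_suml sum_prod_weights// mul1r.
apply: (le_trans (ler_norm_sum _ _ _)); apply: ler_sum => z _.
rewrite (_ : \sum_a _ = (\prod_i p i (z i)) * \sum_a (q a - p k a) * h (upd z k a)).
  by rewrite normrM ger0_norm ?prodr_ge0// ler_wpM2l ?prodr_ge0.
rewrite mulr_sumr; apply: eq_bigr => a _; rewrite ffunE eqxx (bigD1 k)//=.
rewrite (_ : W _ = \prod_(i | i != k) p i (z i)); last first.
  by apply: eq_bigr => i /negbTE ik; rewrite ffunE ik.
rewrite (_ : h [ffun i => if i == k then a else z i] = h (upd z k a)); last first.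
  by congr h; apply/funext => i; rewrite ffunE.
ring.
Qed.

(** Telescoping along the enumeration of [I]: [mix s] has the weights [p] on [s] and [q] elsewhere.
    Uniqueness of [s] guarantees that a coordinate [k] about to be added still carries [q k]. *)
Lemma finite_lindeberg (R : realFieldType) (I Z : finType) (p q : I -> Z -> R)
    (h : (I -> Z) -> R) (c : I -> R) :
  (forall i z, 0 <= p i z) -> (forall i, \sum_z p i z = 1) ->
  (forall i z, 0 <= q i z) -> (forall i, \sum_z q i z = 1) ->
  (forall k (z : {ffun I -> Z}), `|\sum_a (p k a - q k a) * h (upd z k a)| <= c k) ->
  `|\sum_(z : {ffun I -> Z}) (\prod_i p i (z i)) * h z
    - \sum_(z : {ffun I -> Z}) (\prod_i q i (z i)) * h z| <= \sum_k c k.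
Proof.
move=> p0 p1 q0 q1 hc.
pose mix (s : seq I) i z := if i \in s then p i z else q i z.
suff H (s : seq I) : uniq s ->
    `|\sum_(z : {ffun I -> Z}) (\prod_i mix s i (z i)) * h z
    - \sum_(z : {ffun I -> Z}) (\prod_i q i (z i)) * h z| <= \sum_(k <- s) c k.
  have mixT : mix (index_enum I) = p.
    by apply/funext => i; apply/funext => z; rewrite /mix mem_index_enum.
  by have := H _ (index_enum_uniq I); rewrite mixT.
elim: s => [_|k s IH /= /andP[ks us]].
  by rewrite big_nil /mix /= subrr normr0.
rewrite big_cons.
set S := \sum_(z : {ffun I -> Z}) (\prod_i mix s i (z i)) * h z.
apply: (le_trans (ler_distD S _ _)); apply: lerD; last exact: IH.
rewrite {}/S.
rewrite (_ : \sum_(z : {ffun I -> Z}) (\prod_i mix (k :: s) i (z i)) * h z =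
  \sum_(z : {ffun I -> Z}) (\prod_i (if i == k then p k (z i) else mix s i (z i))) * h z).
  apply: finite_swap.
  - by move=> i z; rewrite /mix; case: ifP.
  - by move=> i; rewrite /mix; case: (i \in s); [exact: p1|exact: q1].
  - by move=> z; rewrite /mix (negbTE ks).
apply: eq_bigr => z _; congr (_ * _); apply: eq_bigr => i _.
by rewrite /mix inE; case: eqP => [->|].
Qed.

(** * Discretization of independent families *)

Section cells.
Context (R : realType) d (T : measurableType d) (P : probability T R) (I Z : finType).
Variables (X : I -> {RV P >-> R}) (q : R -> Z).
Hypothesis mq : forall a, measurable (q @^-1` [set a]).

Definition cell_prob (i : I) (a : Z) : R := fine (P (X i @^-1` (q @^-1` [set a]))).

Let cell_event (z : {ffun I -> Z}) : set T := \bigcap_i (X i @^-1` (q @^-1` [set z i])).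

Let measurable_cell i a : measurable (X i @^-1` (q @^-1` [set a])).
Proof. by rewrite -[_ @^-1` _]setTI; exact: measurable_funP. Qed.

Let measurable_cell_event z : measurable (cell_event z).
Proof.
rewrite /cell_event.
by apply: fin_bigcap_measurable => // i _; exact: measurable_cell.
Qed.

(** Only finitely many values occur, so an arbitrary [h] becomes a combination of indicators;
    measurability and integrals both reduce to the cell events. *)
Lemma cell_expansion (h : (I -> Z) -> R) t :
  h (fun i => q (X i t)) = \sum_(z : {ffun I -> Z}) h z * \1_(cell_event z) t.
Proof.
rewrite (bigD1 [ffun i => q (X i t)])//= big1 => [|z zt].
  rewrite addr0 indicE mem_set ?mulr1.
    by congr h; apply/funext => i; rewrite ffunE.
  by move=> i _ /=; rewrite ffunE.
rewrite indicE memNset ?mulr0// => Ez; move/eqP: zt; apply.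
by apply/ffunP => i; rewrite ffunE -(Ez i Logic.I).
Qed.

Lemma measurable_cell_fun (h : (I -> Z) -> R) :
  measurable_fun setT (fun t => h (fun i => q (X i t))).
Proof.
under eq_fun do rewrite cell_expansion.
apply: measurable_sum => z; apply: measurable_funM => //.
Qed.

Hypothesis indep : independent_family X.

(** Independence enters the proof here: it factorizes the probability of each cell event. *)
Lemma integral_cells (h : (I -> Z) -> R) :
  (\int[P]_t (h (fun i => q (X i t)))%:E =
   (\sum_(z : {ffun I -> Z}) (\prod_i cell_prob i (z i)) * h z)%:E)%E.
Proof.
under eq_integral do rewrite cell_expansion -sumEFin.
rewrite integral_sum//=; last first.
  move=> z; under eq_fun do rewrite EFinM.
  by apply: integrableZl => //; exact: integrable_indic.
rewrite -sumEFin; apply: eq_bigr => z _.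
under eq_integral do rewrite EFinM.
rewrite integralZl//; last exact: integrable_indic.
rewrite integral_indic// setIT mulrC EFinM; congr (_ * _)%E.
apply: (etrans (indep (fun i => mq (z i)))).
rewrite -prodEFin; apply: eq_bigr => i _.
by rewrite /cell_prob fineK// fin_num_measure.
Qed.

Lemma cell_prob_ge0 i a : 0 <= cell_prob i a.
Proof. exact: fine_ge0. Qed.

Lemma integral_cell i (f : Z -> R) :
  (\int[P]_t (f (q (X i t)))%:E = (\sum_a cell_prob i a * f a)%:E)%E.
Proof.
have fE t : f (q (X i t)) = \sum_a f a * \1_(X i @^-1` (q @^-1` [set a])) t.
  rewrite (bigD1 (q (X i t)))//= big1 => [|a /eqP at_].
    by rewrite addr0 indicE mem_set ?mulr1.
  by rewrite indicE memNset ?mulr0// => /esym.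
under eq_integral do rewrite fE -sumEFin.
rewrite integral_sum//=; last first.
  move=> z; under eq_fun do rewrite EFinM.
  by apply: integrableZl => //; exact: integrable_indic.
rewrite -sumEFin; apply: eq_bigr => a _.
under eq_integral do rewrite EFinM.
rewrite integralZl//; last exact: integrable_indic.
rewrite integral_indic// setIT mulrC EFinM; congr (_ * _)%E.
by rewrite /cell_prob fineK// fin_num_measure.
Qed.

Lemma cell_prob_sum1 i : \sum_a cell_prob i a = 1.
Proof.
have := expectation_cst P 1; rewrite expectation.unlock => int1.
have := integral_cell i (fun=> 1); rewrite [X in X = _ -> _]int1.
by under eq_bigr do rewrite mulr1; case.
Qed.

End cells.

Section rounding.
Variable R : realType.

(* The grid is symmetric and rounding is towards 0, so that moments of the rounded variables
   are dominated by those of the original ones. *)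
Definition grid_index (n : nat) (x : R) : bool * 'I_(n * n).+1 :=
  (x < 0, inord (minn (Num.truncn (n%:R * `|x|)) (n * n))).

Definition grid_value (n : nat) (a : bool * 'I_(n * n).+1) : R :=
  (-1) ^+ a.1 * (a.2 : nat)%:R / n%:R.

Definition round_grid n x := grid_value (grid_index n x).

Lemma measurable_grid_index n a : measurable (grid_index n @^-1` [set a]).
Proof.
case: a => b k.
(* The cell of index [k] is [k <= n |x| < k + 1], except that the last index [n * n] collects
   everything beyond; hence the guard [k < n * n] on the removed part. *)
have -> : grid_index n @^-1` [set (b, k)] =
    [set x | (x < 0) = b] `&` ([set x | (k%:R <= n%:R * `|x|)%R] `\`
     [set x | (k < n * n)%N && (k.+1%:R <= n%:R * `|x|)%R]).
  apply/seteqP; split => x /=; rewrite /grid_index.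
    move=> [-> kE]; split => //; have {}kE : (k = minn (Num.truncn (n%:R * `|x|)) (n * n) :> nat).
      by rewrite -kE inordK// ltnS geq_minr.
    have x0 : 0 <= n%:R * `|x| by rewrite mulr_ge0.
    rewrite -!truncn_ge_nat//; split; first by rewrite kE geq_minl.
    by apply/negP; move: (Num.truncn _) kE => N; lia.
  move=> [-> []]; have x0 : 0 <= n%:R * `|x| by rewrite mulr_ge0.
  rewrite -!truncn_ge_nat// => k1 /negP k2; congr (_, _).
  apply/val_inj; rewrite /= inordK ?ltnS ?geq_minr//.
  by have := ltn_ord k; move: (Num.truncn _) k1 k2 => N; lia.
have mabs : measurable_fun setT (fun x : R => n%:R * `|x|).
  by apply: measurable_funM => //; exact: measurable_normr.
apply: measurableI.
  case: b.
    rewrite (_ : mkset _ = `]-oo, 0[%classic); first exact: measurable_itv.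
    by apply/seteqP; split => x /=; rewrite in_itv.
  rewrite (_ : mkset _ = `[0, +oo[%classic); first exact: measurable_itv.
  by apply/seteqP; split => x /=; rewrite in_itv/= andbT leNgt; [move=> ->|move=> /negbTE].
have m c : measurable [set x : R | (c <= n%:R * `|x|)%R].
  rewrite (_ : mkset _ = setT `&` (fun x : R => n%:R * `|x|) @^-1` `[c, +oo[%classic).
    exact: mabs.
  by apply/seteqP; split => x /=; rewrite in_itv/= andbT//; case.
apply: measurableD => //; case: (k < n * n)%N => /=; first exact: m.
by rewrite (_ : mkset _ = set0)//; apply/seteqP; split.
Qed.

Lemma grid_indexE n x : (grid_index n x).2%:R = Num.min (Num.truncn (n%:R * `|x|))%:R (n * n)%:R :> R.
Proof.
by rewrite /= inordK ?ltnS ?geq_minr// /minn /Order.min ltr_nat; case: ifP.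
Qed.

Lemma norm_round_grid n x : `|round_grid n x| <= `|x|.
Proof.
rewrite /round_grid /grid_value -mulrA normrM normrX normrN1 expr1n mul1r.
rewrite ger0_norm ?divr_ge0// grid_indexE.
have [->|n0] := posnP n; first by rewrite invr0 mulr0.
rewrite ler_pdivrMr ?ltr0n// [leRHS]mulrC.
rewrite ge_min; apply/orP; left.
by rewrite truncn_le mulr_ge0.
Qed.

(** The mesh is [1 / n] and the cap [n * n] corresponds to the value [n], so it is inactive when
    [|x| <= n]. For [n = 0] the hypothesis forces [x = 0], and division by zero returns 0. *)
Lemma round_grid_near n x : `|x| <= n%:R -> `|x - round_grid n x| <= n%:R^-1.
Proof.
move=> xn; have [n0|n0] := posnP n.
  move: xn; rewrite n0 normr_le0 => /eqP ->.
  by rewrite /round_grid /grid_value invr0 !mulr0 subrr normr0.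
have n0' : 0 < n%:R :> R by rewrite ltr0n.
have xE : x = (-1) ^+ (x < 0)%R * `|x| by rewrite -realEsign// num_real.
rewrite {1}xE /round_grid /grid_value /= -mulrA -mulrBr normrM normrX normrN1 expr1n mul1r.
have := grid_indexE n x; rewrite /= => ->.
have t0 : 0 <= n%:R * `|x| by rewrite mulr_ge0.
have /andP[t1 t2] := truncn_itv t0.
rewrite min_l; last first.
  by rewrite (le_trans t1)// natrM ler_pM2l.
rewrite ger0_norm; last by rewrite subr_ge0 ler_pdivrMr// [leRHS]mulrC.
rewrite -(ler_pM2r n0') mulVf ?gt_eqF// mulrBl mulfVK ?gt_eqF//.
by rewrite lerBlDr mulrC ltW// (lt_le_trans t2)// -natr1 addrC.
Qed.

Lemma cvg_round_grid x : round_grid n x @[n --> \oo] --> x.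
Proof.
apply/cvgrPdist_le => e e0; near=> n.
apply: (@le_trans _ _ n%:R^-1).
  apply: round_grid_near; near: n; exact: nbhs_infty_ger.
rewrite invf_ple ?posrE//; near: n; first exact: nbhs_infty_ger.
by exists 1%N => // n /=; rewrite ltr0n.
Unshelve. all: by end_near. Qed.

End rounding.

Definition l1_lipschitz (R : realType) (I : finType) (C : R) (h : (I -> R) -> R) :=
  forall x y, `|h x - h y| <= C * \sum_i `|x i - y i|.

Lemma cvg_round_l1_lipschitz (R : realType) (I : finType) (C : R) (h : (I -> R) -> R) x :
  l1_lipschitz C h ->
  h (fun i => round_grid n (x i)) @[n --> \oo] --> h x.
Proof.
move=> hC; apply/subr_cvg0; apply/norm_cvg0P.
have bnd : C * \sum_i `|round_grid n (x i) - x i| @[n --> \oo] --> (0 : R).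
  have sum0 (s : seq I) :
      \sum_(i <- s) `|round_grid n (x i) - x i| @[n --> \oo] --> (0 : R).
    elim: s => [|i s IH]; first by under eq_fun do rewrite big_nil; exact: cvg_cst.
    under eq_fun do rewrite big_cons.
    have xi : `|round_grid n (x i) - x i| @[n --> \oo] --> (0 : R).
      by apply/norm_cvg0P/subr_cvg0; exact: cvg_round_grid.
    have H : `|round_grid n (x i) - x i| + \sum_(i <- s) `|round_grid n (x i) - x i|
        @[n --> \oo] --> (0 + 0 : R) by exact: (cvgD xi IH).
    by rewrite addr0 in H.
  have H : C * \sum_i `|round_grid n (x i) - x i| @[n --> \oo] --> (C * 0 : R).
    by apply: cvgMl_tmp; exact: sum0.
  by rewrite mulr0 in H.
apply: (squeeze_cvgr _ _ bnd); last exact: cvg_cst.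
by apply: nearW => n; rewrite normr_ge0 hC.
Qed.

(** * Refining the grid: measurability and dominated convergence *)

Section limits.
Context (R : realType) d (T : measurableType d) (P : probability T R) (I : finType).
Variable X : I -> {RV P >-> R}.

(** By the Lipschitz bound, the function is the pointwise limit of its values at the rounded
    entries, and those are measurable because they take finitely many values on measurable cells. *)
Lemma measurable_l1_lipschitz (C : R) (h : (I -> R) -> R) : l1_lipschitz C h ->
  measurable_fun setT (fun t => h (fun i => X i t)).
Proof.
move=> hC.
apply: (measurable_fun_cvg (h := fun n t => h (fun i => round_grid n (X i t)))).
  move=> n; exact: (measurable_cell_fun X (@measurable_grid_index R n)
    (fun z => h (fun i => grid_value R (z i)))).
by move=> t _; exact: (cvg_round_l1_lipschitz hC).
Qed.

Lemma bounded_integrable (f : T -> R) (K : R) : measurable_fun setT f ->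
  (forall t, `|f t| <= K) -> P.-integrable setT (EFin \o f).
Proof.
move=> mf fK; apply: (le_integrable _ _ _ (finite_measure_integrable_cst P K measurableT)) => //.
- exact/measurable_EFinP.
- by move=> t _ /=; rewrite lee_fin (le_trans (fK t))// ler_norm.
Qed.

Lemma cvg_Rintegral_round (f : T -> R) (f_ : nat -> T -> R) (g : T -> R) :
  (forall n, measurable_fun setT (f_ n)) -> measurable_fun setT f ->
  (forall t, f_ n t @[n --> \oo] --> f t) ->
  P.-integrable setT (EFin \o g) -> (forall n t, `|f_ n t| <= g t) ->
  \int[P]_t f_ n t @[n --> \oo] --> \int[P]_t f t.
Proof.
move=> mf_ mf cf ig fg; rewrite /Rintegral.
have [if1 _ cv] := @dominated_convergence _ _ _ P setT measurableT (fun n t => (f_ n t)%:E)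
   (fun t => (f t)%:E) (EFin \o g) ltac:(by move=> n; apply/measurable_EFinP)
   ltac:(by apply/measurable_EFinP)
   ltac:(by apply/aeW => t _; apply/cvg_EFin; [exact: nearW|exact: cf]) ig
   ltac:(by apply/aeW => t n _; rewrite lee_fin).
have H : (\int[P]_t (f_ n t)%:E)%E @[n --> \oo] --> (fine (\int[P]_t (f t)%:E))%:E.
  by rewrite fineK//; exact: integrable_fin_num if1.
exact: (fine_cvg H).
Qed.

End limits.

(** * Lindeberg replacement *)

Section moments.
Context (R : realType) d (T : measurableType d) (P : probability T R) (I : finType).
Variable X : I -> {RV P >-> R}.

Lemma Rintegral_round_coord n i (f : R -> R) :
  \int[P]_t f (round_grid n (X i t)) =
  \sum_a cell_prob X (grid_index n) i a * f (grid_value R a).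
Proof.
have := integral_cell X (@measurable_grid_index R n) i (fun a => f (grid_value R a)).
by rewrite /Rintegral /round_grid => ->.
Qed.

Lemma Rintegral_round n (h : (I -> R) -> R) : independent_family X ->
  \int[P]_t h (fun i => round_grid n (X i t)) =
  \sum_(z : {ffun I -> bool * 'I_(n * n).+1})
    (\prod_i cell_prob X (grid_index n) i (z i)) * h (fun i => grid_value R (z i)).
Proof.
move=> indX.
have := integral_cells (@measurable_grid_index R n) indX
  (fun z => h (fun i => grid_value R (z i))).
by rewrite /Rintegral /round_grid => ->.
Qed.

Lemma measurable_round_coord n i (f : R -> R) :
  measurable_fun setT (fun t => f (round_grid n (X i t))).
Proof.
exact: (measurable_cell_fun (fun _ : unit => X i) (@measurable_grid_index R n)
  (fun z => f (grid_value R (z tt)))).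
Qed.

Lemma cvg_Rintegral_round_moment l i :
  P.-integrable setT (fun t => (`|X i t| ^+ l)%:E) ->
  \int[P]_t (round_grid n (X i t)) ^+ l @[n --> \oo] --> \int[P]_t (X i t) ^+ l.
Proof.
move=> iX; apply: (cvg_Rintegral_round (g := fun t => `|X i t| ^+ l)) => //.
- by move=> n; exact: (measurable_round_coord n i (fun x => x ^+ l)).
- exact: measurable_funX.
- move=> t; elim: l {iX} => [|l IH]; first by under eq_fun do rewrite expr0; exact: cvg_cst.
  under eq_fun do rewrite exprS.
  by rewrite exprS; apply: cvgM => //; exact: cvg_round_grid.
- by move=> n t; rewrite normrX lerXn2r ?nnegrE// norm_round_grid.
Qed.

Lemma Rintegral_round_abs_le l n i :
  P.-integrable setT (fun t => (`|X i t| ^+ l)%:E) ->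
  \int[P]_t (`|round_grid n (X i t)| ^+ l) <= \int[P]_t (`|X i t| ^+ l).
Proof.
move=> iX; apply: le_Rintegral => //.
  apply: (le_integrable _ _ _ iX) => //=.
    by apply/measurable_EFinP; exact: (measurable_round_coord n i (fun x => `|x| ^+ l)).
  move=> t _; rewrite lee_fin !normrX !normr_id.
  by rewrite lerXn2r ?nnegrE// norm_round_grid.
by move=> t _; rewrite lerXn2r ?nnegrE// norm_round_grid.
Qed.

Lemma cvg_Rintegral_round_l1_lipschitz (C K : R) (h : (I -> R) -> R) :
  l1_lipschitz C h -> (forall x, `|h x| <= K) ->
  \int[P]_t h (fun i => round_grid n (X i t)) @[n --> \oo] -->
  \int[P]_t h (fun i => X i t).
Proof.
move=> hC hK; apply: (cvg_Rintegral_round (g := fun _ => K)) => //.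
- move=> n; exact: (measurable_cell_fun X (@measurable_grid_index R n)
    (fun z => h (fun i => grid_value R (z i)))).
- exact: measurable_l1_lipschitz hC.
- by move=> t; exact: (cvg_round_l1_lipschitz hC).
- exact: finite_measure_integrable_cst.
Qed.

End moments.

(* [upd x k 0] rather than [x] is the centre of the expansion: the coefficients then do not
   depend on the coordinate [k] of [x]. *)
Definition third_order_expansion (R : realType) (I : finType) (D c : R) (h : (I -> R) -> R) :=
  forall k x, exists p1 p2, [/\ `|p1| <= D, `|p2| <= D &
    forall a, `|h (upd x k a) - h (upd x k 0) - p1 * a - p2 * a ^+ 2| <= c * `|a| ^+ 3].

Section lindeberg.
Context (R : realType) (I : finType).
Context dA (TA : measurableType dA) (PA : probability TA R).
Context dB (TB : measurableType dB) (PB : probability TB R).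
Variables (A : I -> {RV PA >-> R}) (B : I -> {RV PB >-> R}).
Hypothesis indA : independent_family A.
Hypothesis indB : independent_family B.

(** Both weights sum to 1, so [f0] cancels. The linear and quadratic terms leave the differences of
    the first two moments, kept explicit since rounded variables no longer match exactly; the
    remainder is paid by third absolute moments. *)
Lemma sum_cell_expansion (Z : finType) (p q v : Z -> R) (f : R -> R) (D c p1 p2 f0 : R) :
  (forall a, 0 <= p a) -> \sum_a p a = 1 ->
  (forall a, 0 <= q a) -> \sum_a q a = 1 ->
  `|p1| <= D -> `|p2| <= D ->
  (forall a, `|f a - f0 - p1 * a - p2 * a ^+ 2| <= c * `|a| ^+ 3) ->
  `|\sum_a (p a - q a) * f (v a)| <=
    D * `|\sum_a p a * v a - \sum_a q a * v a| +
    D * `|\sum_a p a * v a ^+ 2 - \sum_a q a * v a ^+ 2| +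
    c * (\sum_a p a * `|v a| ^+ 3 + \sum_a q a * `|v a| ^+ 3).
Proof.
move=> p_ge0 p_1 q_ge0 q_1 p1D p2D fE.
pose r a := f a - f0 - p1 * a - p2 * a ^+ 2.
have -> : \sum_a (p a - q a) * f (v a) =
    p1 * (\sum_a p a * v a - \sum_a q a * v a) +
    p2 * (\sum_a p a * v a ^+ 2 - \sum_a q a * v a ^+ 2) +
    (\sum_a (p a - q a) * r (v a)).
  rewrite -!sumrB !mulr_sumr -!big_split/=.
  transitivity (\sum_a (p a - q a) * f (v a) - f0 * (\sum_a p a - \sum_a q a)).
    by rewrite p_1 q_1 subrr mulr0 subr0.
  rewrite -sumrB mulr_sumr -sumrB; apply: eq_bigr => a _; rewrite /r; ring.
apply: (le_trans (ler_normD _ _)); apply: lerD.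
  apply: (le_trans (ler_normD _ _)).
  by rewrite !normrM; apply: lerD; exact: ler_wpM2r.
rewrite -big_split/= mulr_sumr; apply: (le_trans (ler_norm_sum _ _ _)).
apply: ler_sum => a _; rewrite normrM.
have pq : `|p a - q a| <= p a + q a.
  by rewrite (le_trans (ler_normB _ _))// !ger0_norm.
apply: (le_trans (ler_pM (normr_ge0 _) (normr_ge0 _) pq (fE (v a)))).
by rewrite le_eqVlt; apply/orP; left; apply/eqP; ring.
Qed.

(** Rounding spoils the matching of moments by an error [e] that tends to 0 as the grid is refined.
    [D] multiplies only this error and is fixed, so it disappears in the limit; third absolute
    moments do not increase under rounding, so [c] times the original ones remains. *)
Lemma lindeberg (C K D c : R) (h : (I -> R) -> R) :
  (forall i, PA.-integrable setT (fun t => (`|A i t| ^+ 3)%:E)) ->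
  (forall i, PB.-integrable setT (fun t => (`|B i t| ^+ 3)%:E)) ->
  (forall i l, (1 <= l <= 2)%N ->
    [/\ PA.-integrable setT (fun t => (`|A i t| ^+ l)%:E),
        PB.-integrable setT (fun t => (`|B i t| ^+ l)%:E) &
        \int[PA]_t (A i t) ^+ l = \int[PB]_t (B i t) ^+ l]) ->
  0 <= c -> l1_lipschitz C h -> (forall x, `|h x| <= K) -> third_order_expansion D c h ->
  `|\int[PA]_t h (fun i => A i t) - \int[PB]_t h (fun i => B i t)| <=
  c * \sum_i (\int[PA]_t `|A i t| ^+ 3 + \int[PB]_t `|B i t| ^+ 3).
Proof.
move=> iA iB mAB c0 hC hK hT.
pose e l n i := \int[PA]_t round_grid n (A i t) ^+ l - \int[PB]_t round_grid n (B i t) ^+ l.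
pose M i := \int[PA]_t `|A i t| ^+ 3 + \int[PB]_t `|B i t| ^+ 3.
pose b n := \sum_i (D * `|e 1%N n i| + D * `|e 2%N n i| + c * M i).
have step n : `|\int[PA]_t h (fun i => round_grid n (A i t)) -
    \int[PB]_t h (fun i => round_grid n (B i t))| <= b n.
  rewrite !Rintegral_round//.
  apply: (finite_lindeberg (h := fun z => h (fun i => grid_value R (z i)))).
  - by move=> i z; exact: cell_prob_ge0.
  - by move=> i; apply: cell_prob_sum1 => //; exact: measurable_grid_index.
  - by move=> i z; exact: cell_prob_ge0.
  - by move=> i; apply: cell_prob_sum1 => //; exact: measurable_grid_index.
  move=> k z; pose x i := grid_value R (z i).
  have updE a : (fun i => grid_value R (upd z k a i)) = upd x k (grid_value R a).
    by apply/funext => i; rewrite /upd /x; case: eqP.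
  under eq_bigr do rewrite updE.
  have [p1 [p2 [p1D p2D fE]]] := hT k x.
  apply: (le_trans (sum_cell_expansion (@grid_value R n) (f := fun a => h (upd x k a))
    _ _ _ _ p1D p2D fE)).
  - by move=> a; exact: cell_prob_ge0.
  - by apply: cell_prob_sum1 => //; exact: measurable_grid_index.
  - by move=> a; exact: cell_prob_ge0.
  - by apply: cell_prob_sum1 => //; exact: measurable_grid_index.
  rewrite -(Rintegral_round_coord _ _ _ (fun x => x ^+ 2)).
  rewrite -(Rintegral_round_coord _ _ _ (fun x => x ^+ 2)).
  rewrite -(Rintegral_round_coord _ _ _ (fun x => x ^+ 1)).
  rewrite -(Rintegral_round_coord _ _ _ (fun x => x ^+ 1)).
  rewrite -(Rintegral_round_coord _ _ _ (fun x => `|x| ^+ 3)).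
  rewrite -(Rintegral_round_coord _ _ _ (fun x => `|x| ^+ 3)).
  rewrite lerD2l ler_wpM2l// /M.
  by apply: lerD; exact: Rintegral_round_abs_le.
have be : b n @[n --> \oo] --> c * \sum_i M i.
  have e0 l i : (1 <= l <= 2)%N -> `|e l n i| @[n --> \oo] --> (0 : R).
    move=> l12; have [iAl iBl eq] := mAB i l l12; apply/norm_cvg0P.
    have H : e l n i @[n --> \oo] --> \int[PA]_t (A i t) ^+ l - \int[PB]_t (B i t) ^+ l.
      by apply: cvgB; exact: cvg_Rintegral_round_moment.
    by rewrite eq subrr in H.
  have bi i : D * `|e 1%N n i| + D * `|e 2%N n i| + c * M i @[n --> \oo] --> c * M i.
    have H : D * `|e 1%N n i| + D * `|e 2%N n i| + c * M i @[n --> \oo] -->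
        D * 0 + D * 0 + c * M i.
      apply: cvgD; last exact: cvg_cst.
      by apply: cvgD; apply: cvgMl_tmp; exact: e0.
    by rewrite mulr0 !add0r in H.
  rewrite mulr_sumr /b.
  elim: (index_enum I) => [|i s IH].
    by rewrite big_nil; under eq_fun do rewrite big_nil; exact: cvg_cst.
  by rewrite big_cons; under eq_fun do rewrite big_cons; exact: (cvgD (bi i) IH).
have lim : `|\int[PA]_t h (fun i => round_grid n (A i t)) -
    \int[PB]_t h (fun i => round_grid n (B i t))| @[n --> \oo] -->
    `|\int[PA]_t h (fun i => A i t) - \int[PB]_t h (fun i => B i t)|.
  apply: cvg_norm; apply: cvgB; exact: cvg_Rintegral_round_l1_lipschitz hC hK.
rewrite -(cvg_lim _ lim)// -(cvg_lim _ be)//.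
apply: ler_lim; [by apply: cvgP lim|by apply: cvgP be|].
by apply: nearW => n; exact: step.
Qed.

End lindeberg.

(** * Bounds on three derivatives *)

Section jets.
Variable R : realType.
Implicit Types (f g y : R -> R) (x a b : R).

Lemma is_derive1D f g x a b : is_derive x 1 f a -> is_derive x 1 g b ->
  is_derive x 1 (fun z => f z + g z) (a + b).
Proof. by move=> ? ?; exact: is_deriveD. Qed.

Lemma is_derive1M f g x a b : is_derive x 1 f a -> is_derive x 1 g b ->
  is_derive x 1 (fun z => f z * g z) (a * g x + f x * b).
Proof.
move=> fa gb; have H := is_deriveM fa gb; apply: (is_derive_eq H).
by rewrite /GRing.scale /=; ring.
Qed.

Lemma is_derive1Z (k : R) f x a : is_derive x 1 f a -> is_derive x 1 (fun z => k * f z) (k * a).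
Proof. by move=> fa; exact: is_deriveZ. Qed.

Lemma is_derive1_sum (J : Type) (s : seq J) (f df : J -> R -> R) x :
  (forall j, is_derive x 1 (f j) (df j x)) ->
  is_derive x 1 (fun z => \sum_(j <- s) f j z) (\sum_(j <- s) df j x).
Proof.
move=> fd; elim: s => [|j s IH].
  by rewrite big_nil; under eq_fun do rewrite big_nil; exact: is_derive_cst.
rewrite big_cons; under eq_fun do rewrite big_cons; exact: is_derive1D.
Qed.

Definition jet3 (f f1 f2 f3 : R -> R) := forall x,
  [/\ is_derive x 1 f (f1 x), is_derive x 1 f1 (f2 x) & is_derive x 1 f2 (f3 x)].

(* Bounds relative to [y] pass to sums and inverses with constants that do not depend on the
   number of terms. *)
Definition relative_jet_bound (B1 B2 B3 : R) y := exists y1 y2 y3, jet3 y y1 y2 y3 /\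
  forall x, [/\ 0 < y x, `|y1 x| <= B1 * y x, `|y2 x| <= B2 * y x & `|y3 x| <= B3 * y x].

Definition jet_bound (B1 B2 B3 : R) f := exists f1 f2 f3, jet3 f f1 f2 f3 /\
  forall x, [/\ `|f1 x| <= B1, `|f2 x| <= B2 & `|f3 x| <= B3].

Lemma relative_jet_bound_exp (c k s : R) : `|k| <= s ->
  relative_jet_bound s (s ^+ 2) (s ^+ 3) (fun x => expR (c + x * k)).
Proof.
move=> ks; pose e x := expR (c + x * k).
have de x : is_derive x 1 e (k * e x).
  have d1 : is_derive x 1 (fun x => c + x * k) k.
    have H := is_derive1D (is_derive_cst c x 1) (is_derive1M (is_derive_id x 1) (is_derive_cst k x 1)).
    by apply: (is_derive_eq H); rewrite mul1r mulr0 addr0 add0r.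
  have H := @is_derive1_comp _ expR (fun x => c + x * k) x _ _ (is_derive_expR (c + x * k)) d1.
  by apply: (is_derive_eq H); rewrite mulrC.
exists (fun x => k * e x), (fun x => k ^+ 2 * e x), (fun x => k ^+ 3 * e x); split.
  move=> x; split => //.
    by apply: (is_derive_eq (is_derive1Z k (de x))); ring.
  by apply: (is_derive_eq (is_derive1Z (k ^+ 2) (de x))); ring.
move=> x; have e0 : 0 < e x by exact: expR_gt0.
split => //; rewrite normrM (gtr0_norm e0) ler_pM2r// ?normrX// lerXn2r ?nnegrE//.
  exact: le_trans ks.
exact: le_trans ks.
Qed.

Lemma relative_jet_bound_sum (J : finType) (j0 : J) (B1 B2 B3 : R) (y : J -> R -> R) :
  (forall j, relative_jet_bound B1 B2 B3 (y j)) ->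
  relative_jet_bound B1 B2 B3 (fun x => \sum_j y j x).
Proof.
move=> /choice[y1] /choice[y2] /choice[y3] H.
exists (fun x => \sum_j y1 j x), (fun x => \sum_j y2 j x), (fun x => \sum_j y3 j x); split.
  move=> x; split; apply: is_derive1_sum => j; by have [/(_ x)[]] := H j.
move=> x; split.
- rewrite (bigD1 j0)//=; apply: ltr_wpDr; last by have [_ /(_ x)[]] := H j0.
  by apply: sumr_ge0 => j _; have [_ /(_ x)[/ltW]] := H j.
- rewrite mulr_sumr (le_trans (ler_norm_sum _ _ _))//; apply: ler_sum => j _.
  by have [_ /(_ x)[]] := H j.
- rewrite mulr_sumr (le_trans (ler_norm_sum _ _ _))//; apply: ler_sum => j _.
  by have [_ /(_ x)[]] := H j.
- rewrite mulr_sumr (le_trans (ler_norm_sum _ _ _))//; apply: ler_sum => j _.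
  by have [_ /(_ x)[]] := H j.
Qed.

(** With [r_k = y_k / y], the derivatives of [1 / y] (relative to [1 / y]) and of [ln y] are, up to
    sign, the two displayed polynomials. The coefficients [p, u, v] are [2, 6, 6] for the inverse
    and [1, 3, 2] for the logarithm. *)
Lemma relative_jet_ratio (r1 r2 r3 B1 B2 B3 p u v : R) :
  `|r1| <= B1 -> `|r2| <= B2 -> `|r3| <= B3 -> 0 <= p -> 0 <= u -> 0 <= v ->
  `|r2 - p * r1 ^+ 2| <= B2 + p * B1 ^+ 2 /\
  `|r3 - u * (r1 * r2) + v * r1 ^+ 3| <= B3 + u * (B1 * B2) + v * B1 ^+ 3.
Proof.
move=> h1 h2 h3 p0 u0 v0.
have B10 : 0 <= B1 by exact: le_trans h1.
have H2 : `|r1 ^+ 2| <= B1 ^+ 2 by rewrite normrX lerXn2r ?nnegrE.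
have H3 : `|r1 ^+ 3| <= B1 ^+ 3 by rewrite normrX lerXn2r ?nnegrE.
have H12 : `|r1 * r2| <= B1 * B2 by rewrite normrM ler_pM.
split.
  apply: (le_trans (ler_normB _ _)); rewrite lerD// normrM ger0_norm// ler_wpM2l//.
apply: (le_trans (ler_normD _ _)); rewrite lerD//; last by rewrite normrM ger0_norm// ler_wpM2l.
apply: (le_trans (ler_normB _ _)); rewrite lerD// normrM ger0_norm// ler_wpM2l//.
Qed.

Lemma ratio_bound (y z B : R) : 0 < y -> `|z| <= B * y -> `|z * y^-1| <= B.
Proof. by move=> y0 zB; rewrite normrM normfV (gtr0_norm y0) ler_pdivrMr. Qed.

Lemma relative_jet_bound_inv (B1 B2 B3 : R) y :
  relative_jet_bound B1 B2 B3 y ->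
  relative_jet_bound B1 (B2 + 2 * B1 ^+ 2) (B3 + 6 * (B1 * B2) + 6 * B1 ^+ 3)
    (fun x => (y x)^-1).
Proof.
move=> [y1 [y2 [y3 [yj yB]]]].
have y0 x : y x != 0 by have [/gt_eqF ->] := yB x.
pose v x := (y x)^-1.
have dv x : is_derive x 1 v (- (y1 x) * (v x * v x)).
  have [d1 _ _] := yj x; apply: (is_derive_eq (is_deriveV (y0 x) d1)).
  by rewrite /GRing.scale /= /v; field.
exists (fun x => - 1 * y1 x * (v x * v x)),
  (fun x => - 1 * y2 x * (v x * v x) + 2 * (y1 x * y1 x) * (v x * v x * v x)),
  (fun x => - 1 * y3 x * (v x * v x) + 6 * (y1 x * y2 x) * (v x * v x * v x)
    + - 6 * (y1 x * y1 x * y1 x) * (v x * v x * v x * v x)); split.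
  move=> x; have [d1 d2 d3] := yj x; have dvv := is_derive1M (dv x) (dv x).
  have dvvv := is_derive1M dvv (dv x).
  split.
  - by apply: (is_derive_eq (dv x)); ring.
  - apply: (is_derive_eq (is_derive1M (is_derive1Z (- 1) d2) dvv)); ring.
  - apply: (is_derive_eq (is_derive1D (is_derive1M (is_derive1Z (- 1) d3) dvv)
      (is_derive1M (is_derive1Z 2 (is_derive1M d2 d2)) dvvv))); ring.
move=> x; have [yp yB1 yB2 yB3] := yB x; have vp : 0 < v x by rewrite invr_gt0.
have h1 := ratio_bound yp yB1; have h2 := ratio_bound yp yB2; have h3 := ratio_bound yp yB3.
have [H1 H2] := relative_jet_ratio h1 h2 h3 (ler0n R 2) (ler0n R 6) (ler0n R 6).
split => //.
- rewrite (_ : _ * _ = - (y1 x * (y x)^-1) * v x); last by rewrite /v; ring.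
  by rewrite normrM normrN (gtr0_norm vp) ler_pM2r.
- rewrite (_ : _ + _ = - (y2 x * (y x)^-1 - 2 * (y1 x * (y x)^-1) ^+ 2) * v x); last first.
    by rewrite /v; ring.
  by rewrite normrM normrN (gtr0_norm vp) ler_pM2r.
- rewrite (_ : _ + _ = - (y3 x * (y x)^-1 - 6 * (y1 x * (y x)^-1 * (y2 x * (y x)^-1)) +
     6 * (y1 x * (y x)^-1) ^+ 3) * v x); last by rewrite /v; ring.
  by rewrite normrM normrN (gtr0_norm vp) ler_pM2r.
Qed.

(** The logarithm turns relative bounds into absolute ones, because its derivatives involve [y] only
    through the ratios [y_k / y]. *)
Lemma jet_bound_ln (B1 B2 B3 : R) y :
  relative_jet_bound B1 B2 B3 y ->
  jet_bound B1 (B2 + 1 * B1 ^+ 2) (B3 + 3 * (B1 * B2) + 2 * B1 ^+ 3) (fun x => ln (y x)).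
Proof.
move=> [y1 [y2 [y3 [yj yB]]]].
have yp x : 0 < y x by have [] := yB x.
have y0 x : y x != 0 by rewrite gt_eqF.
pose v x := (y x)^-1.
have dv x : is_derive x 1 v (- (y1 x) * (v x * v x)).
  have [d1 _ _] := yj x; apply: (is_derive_eq (is_deriveV (y0 x) d1)).
  by rewrite /GRing.scale /= /v; field.
exists (fun x => y1 x * v x),
  (fun x => y2 x * v x + - 1 * (y1 x * y1 x) * (v x * v x)),
  (fun x => y3 x * v x - 3 * (y1 x * v x * (y2 x * v x)) + 2 * (y1 x * v x) ^+ 3); split.
  move=> x; have [d1 d2 d3] := yj x; have dvv := is_derive1M (dv x) (dv x).
  split.
  - have H := is_derive1_comp (is_derive1_ln (yp x)) d1.
    by apply: (is_derive_eq H); rewrite mulrC.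
  - by apply: (is_derive_eq (is_derive1M d2 (dv x))); ring.
  - apply: (is_derive_eq (is_derive1D (is_derive1M d3 (dv x))
      (is_derive1M (is_derive1Z (- 1) (is_derive1M d2 d2)) dvv))); ring.
move=> x; have [_ yB1 yB2 yB3] := yB x.
have h1 := ratio_bound (yp x) yB1; have h2 := ratio_bound (yp x) yB2; have h3 := ratio_bound (yp x) yB3.
have [H1 H2] := relative_jet_ratio h1 h2 h3 (ler0n R 1) (ler0n R 3) (ler0n R 2).
split => //.
rewrite (_ : _ + _ = (y2 x * (y x)^-1 - 1 * (y1 x * (y x)^-1) ^+ 2)) //; rewrite /v; ring.
Qed.

Lemma jet_boundZ (k B1 B2 B3 : R) f : 0 <= k -> jet_bound B1 B2 B3 f ->
  jet_bound (k * B1) (k * B2) (k * B3) (fun x => k * f x).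
Proof.
move=> k0 [f1 [f2 [f3 [fj fB]]]].
exists (fun x => k * f1 x), (fun x => k * f2 x), (fun x => k * f3 x); split => x.
  by have [d1 d2 d3] := fj x; split; exact: is_derive1Z.
by have [b1 b2 b3] := fB x; split; rewrite normrM ger0_norm// ler_wpM2l.
Qed.

(** Faa di Bruno's formula up to order three. *)
Lemma jet_bound_comp (K B1 B2 B3 : R) g f :
  jet_bound K K K g -> jet_bound B1 B2 B3 f ->
  jet_bound (K * B1) (K * (B1 ^+ 2 + B2)) (K * (B1 ^+ 3 + 3 * (B1 * B2) + B3)) (fun x => g (f x)).
Proof.
move=> [g1 [g2 [g3 [gj gB]]]] [f1 [f2 [f3 [fj fB]]]].
exists (fun x => g1 (f x) * f1 x),
  (fun x => g2 (f x) * (f1 x * f1 x) + g1 (f x) * f2 x),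
  (fun x => g3 (f x) * f1 x ^+ 3 + g2 (f x) * (3 * (f1 x * f2 x)) + g1 (f x) * f3 x); split.
  move=> x; have [d1 d2 d3] := fj x; have [e1 e2 e3] := gj (f x).
  have c1 := is_derive1_comp e1 d1; have c2 := is_derive1_comp e2 d1.
  have c3 := is_derive1_comp e3 d1.
  split => //.
  - by apply: (is_derive_eq (is_derive1M c2 d2)) => /=; ring.
  - apply: (is_derive_eq (is_derive1D (is_derive1M c3 (is_derive1M d2 d2)) (is_derive1M c2 d3))) => /=; ring.
move=> x; have [b1 b2 b3] := fB x; have [k1 k2 k3] := gB (f x).
have B10 : 0 <= B1 by exact: le_trans b1.
have H3 : `|f1 x ^+ 3| <= B1 ^+ 3 by rewrite normrX lerXn2r ?nnegrE.
have H2 : `|f1 x * f1 x| <= B1 ^+ 2 by rewrite normrM expr2 ler_pM.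
have H12 : `|3 * (f1 x * f2 x)| <= 3 * (B1 * B2) by rewrite normrM ger0_norm// ler_wpM2l// normrM ler_pM.
split.
- by rewrite normrM ler_pM.
- by rewrite (le_trans (ler_normD _ _))// mulrDr lerD// normrM ler_pM.
- rewrite (le_trans (ler_normD _ _))// mulrDr lerD//; last by rewrite normrM ler_pM.
  by rewrite (le_trans (ler_normD _ _))// mulrDr lerD// normrM ler_pM.
Qed.

(** The derivative bound is required only within distance [|b - a|] of [a]; [taylor3] applies it
    with bounds that grow with the distance. *)
Lemma derive_bound_lipschitz f df (K : R) : (forall x, is_derive x 1 f (df x)) ->
  forall a b, (forall x, `|x - a| <= `|b - a| -> `|df x| <= K) ->
  `|f b - f a| <= K * `|b - a|.
Proof.
move=> fd.
have cf : continuous f.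
  by move=> x; apply/differentiable_continuous/derivable1_diffP; have [] := fd x.
have main a b : a < b -> (forall x, a <= x <= b -> `|df x| <= K) -> `|f b - f a| <= K * `|b - a|.
  move=> ab dK.
  have [c + ->] := MVT ab (fun x _ => fd x) (continuous_subspaceT cf).
  rewrite in_itv /= => /andP[ac cb]; rewrite normrM ler_wpM2r// dK// (ltW ac) (ltW cb) //.
move=> a b; have [ab dK|ba dK|->] := ltgtP a b; last by rewrite !subrr normr0 mulr0.
  apply: main => // x /andP[ax xb]; apply: dK.
  by rewrite !ger0_norm ?subr_ge0 ?(ltW ab)// lerB.
rewrite distrC [`|b - a|]distrC; apply: main => // x /andP[ax xb]; apply: dK.
by rewrite !ler0_norm ?subr_le0 ?(ltW ba)// !opprB lerB.
Qed.

(** The mean value estimate is applied three times, to [f2], then [f1], then [f], each time after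
    subtracting the Taylor polynomial. No integration takes place, which is why the remainder has
    [B3] and not [B3 / 6]. *)
Lemma taylor3 (B1 B2 B3 : R) f : jet_bound B1 B2 B3 f ->
  exists p1 p2, [/\ `|p1| <= B1, `|p2| <= B2 / 2 &
    forall a, `|f a - f 0 - p1 * a - p2 * a ^+ 2| <= B3 * `|a| ^+ 3].
Proof.
move=> [f1 [f2 [f3 [fj fB]]]].
exists (f1 0), (f2 0 / 2); split.
- by have [] := fB 0.
- by have [_ b2 _] := fB 0; rewrite normrM [`|2^-1|]ger0_norm// ler_pM2r.
move=> a; have B30 : 0 <= B3 by have [_ _] := fB 0; exact: le_trans.
have s2 x : `|f2 x - f2 0| <= B3 * `|x|.
  have := @derive_bound_lipschitz f2 f3 B3 _ 0 x; rewrite subr0; apply.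
    by move=> z; have [] := fj z.
  by move=> z _; have [] := fB z.
have s1 x : `|f1 x - f1 0 - f2 0 * x| <= B3 * `|x| ^+ 2.
  have := @derive_bound_lipschitz (fun z => f1 z + (- f2 0) * z) (fun z => f2 z + (- f2 0) * 1) (B3 * `|x|) _ 0 x.
  rewrite subr0 (_ : _ - _ = f1 x - f1 0 - f2 0 * x); last by ring.
  rewrite -mulrA -expr2; apply.
    move=> z; have [_ d2 _] := fj z.
    by apply: is_derive1D => //; apply: is_derive1Z; exact: is_derive_id.
  move=> z; rewrite subr0 => zx; rewrite mulr1; apply: (le_trans (s2 z)).
  by rewrite ler_wpM2l.
have := @derive_bound_lipschitz (fun z => f z + (- 1 * (f1 0 * z) + - 1 * (f2 0 / 2 * (z * z))))
  (fun z => f1 z + (- 1 * (f1 0 * 1) + - 1 * (f2 0 / 2 * (1 * z + z * 1)))) (B3 * `|a| ^+ 2) _ 0 a.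
rewrite subr0 (_ : _ - _ = f a - f 0 - f1 0 * a - f2 0 / 2 * a ^+ 2); last by ring.
rewrite (_ : B3 * `|a| ^+ 2 * `|a| = B3 * `|a| ^+ 3); last by ring.
apply.
  move=> z; have [d1 _ _] := fj z.
  have did := is_derive_id z (1 : R).
  exact: (is_derive1D d1 (is_derive1D (is_derive1Z (- 1) (is_derive1Z (f1 0) did))
    (is_derive1Z (- 1) (is_derive1Z (f2 0 / 2) (is_derive1M did did))))).
move=> z; rewrite subr0 => za.
rewrite (_ : _ + _ = f1 z - f1 0 - f2 0 * z); last by field.
by apply: (le_trans (s1 z)); rewrite ler_wpM2l// lerXn2r ?nnegrE.
Qed.

End jets.

(** * The soft max-min *)

(** The inverse of the inner sum is [exp (beta * m_u)], where [m_u] is the soft minimum over [w];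
    the outer expression is the soft maximum of the [m_u]. With the same [beta] at both levels no
    other power of the inner sum appears, so only exponentials, sums, inverses and one logarithm
    have to be differentiated. *)
Definition soft_maxmin (R : realType) (U W : finType) (beta : R) (X : U -> W -> R) : R :=
  beta^-1 * ln (\sum_u (\sum_w expR (- beta * X u w))^-1).

Section soft_maxmin.
Context (R : realType) (U W : finType) (u0 : U) (w0 : W) (beta : R).
Hypothesis beta0 : 0 < beta.
Implicit Type X : U -> W -> R.

Lemma sum_gt0 (J : finType) (j0 : J) (f : J -> R) : (forall j, 0 < f j) -> 0 < \sum_j f j.
Proof. by move=> f0; rewrite (bigD1 j0)//= ltr_wpDr// sumr_ge0// => j _; exact: ltW. Qed.

Lemma inner_sum_gt0 X u : 0 < \sum_w expR (- beta * X u w).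
Proof. by apply: (sum_gt0 w0) => w; exact: expR_gt0. Qed.

Lemma outer_sum_gt0 X : 0 < \sum_u (\sum_w expR (- beta * X u w))^-1.
Proof. by apply: (sum_gt0 u0) => u; rewrite invr_gt0 inner_sum_gt0. Qed.

Lemma outer_sumE X :
  \sum_u (\sum_w expR (- beta * X u w))^-1 = expR (beta * soft_maxmin beta X).
Proof.
by rewrite /soft_maxmin mulrA mulfV ?gt_eqF// mul1r lnK// posrE outer_sum_gt0.
Qed.

Lemma soft_maxmin_le_shift X X' e : (forall u w, X u w <= X' u w + e) ->
  soft_maxmin beta X <= soft_maxmin beta X' + e.
Proof.
move=> XX'; rewrite -(ler_pM2l beta0) mulrDr -ler_expR expRD -!outer_sumE mulr_suml.
apply: ler_sum => u _; rewrite -[expR (beta * e)]invrK -invfM.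
rewrite lef_pV2 ?posrE ?mulr_gt0 ?invr_gt0 ?inner_sum_gt0 ?expR_gt0//.
rewrite -expRN mulr_suml; apply: ler_sum => w _; rewrite -expRD ler_expR.
by rewrite !mulNr -opprD lerN2 -mulrDr ler_pM2l.
Qed.

Lemma soft_maxmin_dist X X' (e : R) : (forall u w, `|X u w - X' u w| <= e) ->
  `|soft_maxmin beta X - soft_maxmin beta X'| <= e.
Proof.
move=> XX'; rewrite ler_norml; apply/andP; split.
  rewrite lerBrDl -lerBrDr opprK; apply: soft_maxmin_le_shift => u w.
  by have := XX' u w; rewrite ler_norml => /andP[+ _]; lra.
rewrite lerBlDl; apply: soft_maxmin_le_shift => u w.
by have := XX' u w; rewrite ler_norml => /andP[_]; lra.
Qed.

(** If every [X u w] exceeded the bound [k], the inner sum at [u] would be below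
    [#|W| exp (- beta k)], so its inverse, a single term of the outer sum, would already exceed that
    sum. The loss [ln #|W| / beta] comes from the inner sum. *)
Lemma soft_maxmin_ub X u : exists w, X u w <= soft_maxmin beta X + beta^-1 * ln #|W|%:R.
Proof.
apply: contrapT => /forallNP H.
have {}H w : soft_maxmin beta X + beta^-1 * ln #|W|%:R < X u w by rewrite ltNge; apply/negP; exact: H.
have W0 : 0 < #|W|%:R :> R by rewrite ltr0n; apply/card_gt0P; exists w0.
set k := _ + _ in H.
have Z : \sum_w expR (- beta * X u w) < #|W|%:R * expR (- beta * k).
  rewrite mulrC mulr_natr -sumr_const; apply: ltr_sum.
    by apply/hasP; exists w0; rewrite ?mem_index_enum.
  by move=> w _; rewrite ltr_expR !mulNr ltrN2 ltr_pM2l.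
have : (#|W|%:R * expR (- beta * k))^-1 < expR (beta * soft_maxmin beta X).
  apply: (@lt_le_trans _ _ (\sum_w expR (- beta * X u w))^-1).
    by rewrite ltf_pV2 ?posrE ?inner_sum_gt0 ?mulr_gt0 ?expR_gt0.
  rewrite -outer_sumE (bigD1 u)//= lerDl sumr_ge0// => v _.
  by rewrite invr_ge0 ltW ?inner_sum_gt0.
have b0 : beta != 0 by rewrite gt_eqF.
have -> : - beta * k = - ln #|W|%:R - beta * soft_maxmin beta X by rewrite /k; field.
rewrite expRD !expRN lnK ?posrE// mulrA mulfV ?gt_eqF// mul1r invrK ltxx //.
Qed.

(** If each row had an entry below [k], each inverse would be below [exp (beta k)] and the outer sum
    below [#|U| exp (beta k)]. Here the loss comes from the outer sum. *)
Lemma soft_maxmin_lb X : exists u, forall w, soft_maxmin beta X - beta^-1 * ln #|U|%:R <= X u w.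
Proof.
apply: contrapT => /forallNP H.
have {}H u : exists w, X u w < soft_maxmin beta X - beta^-1 * ln #|U|%:R.
  have /existsNP[w /negP] := H u.
  by rewrite -ltNge => ?; exists w.
have U0 : 0 < #|U|%:R :> R by rewrite ltr0n; apply/card_gt0P; exists u0.
set k := _ - _ in H.
have : expR (beta * soft_maxmin beta X) < #|U|%:R * expR (beta * k).
  rewrite -outer_sumE mulrC mulr_natr -sumr_const; apply: ltr_sum.
    by apply/hasP; exists u0; rewrite ?mem_index_enum.
  move=> u _; have [w wk] := H u.
  rewrite -[ltRHS]invrK -expRN ltf_pV2 ?posrE ?inner_sum_gt0 ?expR_gt0//.
  rewrite (bigD1 w)//=; apply: ltr_wpDr.
    by apply: sumr_ge0 => v _; exact/ltW/expR_gt0.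
  by rewrite ltr_expR mulNr ltrN2 ltr_pM2l.
have b0 : beta != 0 by rewrite gt_eqF.
have -> : beta * k = - ln #|U|%:R + beta * soft_maxmin beta X by rewrite /k; field.
by rewrite expRD expRN lnK ?posrE// mulrA mulfV ?gt_eqF// mul1r ltxx.
Qed.

(** With [x = beta * D] the relative bounds of the inner sum are [x, x^2, x^3]; the inverse gives
    [x, 3 x^2, 13 x^3], and the logarithm [x, 4 x^2, 24 x^3]. Dividing by [beta] yields the
    constants. *)
Lemma jet_bound_soft_maxmin (D : R) (c d : U -> W -> R) : (forall u w, `|d u w| <= D) ->
  jet_bound D (4 * beta * D ^+ 2) (24 * beta ^+ 2 * D ^+ 3)
    (fun a => soft_maxmin beta (fun u w => c u w + a * d u w)).
Proof.
move=> dD.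
have H u : relative_jet_bound (beta * D) ((beta * D) ^+ 2) ((beta * D) ^+ 3)
    (fun a => \sum_w expR (- beta * (c u w + a * d u w))).
  apply: (relative_jet_bound_sum w0) => w.
  under eq_fun do rewrite mulrDr mulrCA.
  by apply: relative_jet_bound_exp; rewrite normrM normrN (gtr0_norm beta0) ler_pM2l.
have := jet_bound_ln (relative_jet_bound_sum u0 (fun u => relative_jet_bound_inv (H u))).
have bi0 : 0 <= beta^-1 by rewrite invr_ge0 ltW.
move=> /(jet_boundZ bi0); rewrite /soft_maxmin.
have b0 : beta != 0 by rewrite gt_eqF.
set B1 := _ * (_ * _); set B2 := (_ * (_ + _)); set B3 := (_ * (_ + _)).
have -> : B1 = D by rewrite /B1; field.
have -> : B2 = 4 * beta * D ^+ 2 by rewrite /B2; field.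
by have -> : B3 = 24 * beta ^+ 2 * D ^+ 3 by rewrite /B3; field.
Qed.

End soft_maxmin.

(** * Max-min over arbitrary sets and its distance to the soft max-min on nets *)

Section maxmin.
Variable R : realType.

Definition emaxmin (U W : Type) (Su : set U) (Sw : set W) (X : U -> W -> R) : \bar R :=
  ereal_sup [set ereal_inf [set (X u w)%:E | w in Sw] | u in Su].

Lemma maxminE (U W : Type) (Su : set U) (Sw : set W) (X : U -> W -> R) :
  maxmin Su Sw X = fine (emaxmin Su Sw X).
Proof. by []. Qed.

Lemma emaxmin_le (U W : Type) (Su : set U) (Sw : set W) (X X' : U -> W -> R) (e : R) :
  (forall u w, Su u -> Sw w -> X u w <= X' u w + e) ->
  (emaxmin Su Sw X <= emaxmin Su Sw X' + e%:E)%E.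
Proof.
move=> XX'; apply: ge_ereal_sup => _ [u Suu <-].
rewrite -leeBlDr//; apply: (@le_trans _ _ (ereal_inf [set (X' u w)%:E | w in Sw])); last first.
  by apply: ereal_sup_ubound; exists u.
apply: le_ereal_inf_tmp => _ [w Sww <-]; rewrite leeBlDr//.
apply: (@le_trans _ _ (X u w)%:E); first by apply: ereal_inf_lbound; exists w.
by rewrite -EFinD lee_fin XX'.
Qed.

(** The two inequalities force both values to be finite or to be the same infinity, so the default 0
    of [fine] causes no jump. *)
Lemma fine_dist (x y : \bar R) (e : R) : 0 <= e ->
  (x <= y + e%:E)%E -> (y <= x + e%:E)%E -> `|fine x - fine y| <= e.
Proof.
move=> e0; case: x => [x||]; case: y => [y||] //=; rewrite ?subrr ?normr0//.
by rewrite -!EFinD !lee_fin => xy yx; rewrite ler_norml; apply/andP; split; lra.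
Qed.

Lemma maxmin_dist (U W : Type) (Su : set U) (Sw : set W) (X X' : U -> W -> R) (e : R) :
  0 <= e -> (forall u w, Su u -> Sw w -> `|X u w - X' u w| <= e) ->
  `|maxmin Su Sw X - maxmin Su Sw X'| <= e.
Proof.
move=> e0 XX'; rewrite !maxminE; apply: fine_dist => //; apply: emaxmin_le => u w Suu Sww.
  by have := XX' u w Suu Sww; rewrite ler_norml => /andP[_]; lra.
by have := XX' u w Suu Sww; rewrite ler_norml => /andP[+ _]; lra.
Qed.

(** In each direction only one vector is moved to its net point: [u] for the upper bound, after
    which the good column of [soft_maxmin_ub] lies in [Sw]; [w] for the lower bound, where the good
    row of [soft_maxmin_lb] lies in [Su]. Hence [e] is paid once. *)
Lemma maxmin_soft_maxmin (U W : Type) (Su : set U) (Sw : set W) (X : U -> W -> R)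
    (JU JW : finType) (u0 : JU) (w0 : JW) (ru : JU -> U) (rw : JW -> W)
    (cu : U -> JU) (cw : W -> JW) (beta e : R) :
  0 < beta -> (forall c, Su (ru c)) -> (forall c, Sw (rw c)) ->
  (forall u w, Su u -> Sw w -> `|X u w - X (ru (cu u)) w| <= e) ->
  (forall u w, Su u -> Sw w -> `|X u w - X u (rw (cw w))| <= e) ->
  `|maxmin Su Sw X - soft_maxmin beta (fun c c' => X (ru c) (rw c'))| <=
    e + beta^-1 * (ln #|JU|%:R + ln #|JW|%:R).
Proof.
move=> beta0 Sru Srw hu hw.
have lnJ (J : finType) (j : J) : 0 <= beta^-1 * ln #|J|%:R :> R.
  apply: mulr_ge0; first by rewrite invr_ge0 ltW.
  apply: ln_ge0; rewrite ler1n.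
  by apply/card_gt0P; exists j.
have lU := lnJ _ u0; have lW := lnJ _ w0; rewrite mulrDr.
have e0 : 0 <= e by exact: le_trans (normr_ge0 _) (hu _ _ (Sru u0) (Srw w0)).
set s := soft_maxmin _ _; rewrite maxminE -[s]/(fine s%:E).
apply: fine_dist; first by lra.
  apply: ge_ereal_sup => _ [u Suu <-].
  have [c'] := soft_maxmin_ub u0 w0 beta0 (fun c c' => X (ru c) (rw c')) (cu u).
  rewrite -/s => sub; apply: (@le_trans _ _ (X u (rw c'))%:E).
    by apply: ereal_inf_lbound; exists (rw c').
  have := hu u (rw c') Suu (Srw c'); rewrite -EFinD lee_fin ler_norml => /andP[_]; lra.
have [c sc] := soft_maxmin_lb u0 w0 beta0 (fun c c' => X (ru c) (rw c')).
rewrite -leeBlDr//; apply: (@le_trans _ _ (ereal_inf [set (X (ru c) w)%:E | w in Sw])); last first.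
  by apply: ereal_sup_ubound; exists (ru c).
apply: le_ereal_inf_tmp => _ [w Sww <-]; rewrite -EFinB lee_fin.
have := hw (ru c) w (Sru c) Sww; rewrite ler_norml => /andP[].
by have := sc (cw w); rewrite -/s; lra.
Qed.

End maxmin.

(** * Payoffs that are affine in the family of entries *)

Section affine_payoff.
Context (R : realType) (I : finType).

(** The bilinear form is read as linear in the entries, with coefficients [d]. The strategy types
    are arbitrary, so that the same form serves the original sets and the finite nets. *)
Definition affine_payoff (U W : Type) (d : I -> U -> W -> R) (Q : U -> W -> R)
  (x : I -> R) (u : U) (w : W) : R := \sum_i x i * d i u w + Q u w.

Lemma affine_payoff_dist (U W : Type) (d : I -> U -> W -> R) (Q : U -> W -> R) (D : R) x y u w :
  (forall i, `|d i u w| <= D) ->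
  `|affine_payoff d Q x u w - affine_payoff d Q y u w| <= D * \sum_i `|x i - y i|.
Proof.
move=> dD; rewrite /affine_payoff opprD addrACA subrr addr0 -sumrB mulr_sumr.
apply: (le_trans (ler_norm_sum _ _ _)); apply: ler_sum => i _.
by rewrite -mulrBl normrM mulrC ler_wpM2r.
Qed.

Lemma affine_payoff_move (U W : Type) (d : I -> U -> W -> R) (Q : U -> W -> R) (eta omega : R)
    x u w u' w' :
  (forall i, `|d i u w - d i u' w'| <= eta) -> `|Q u w - Q u' w'| <= omega ->
  `|affine_payoff d Q x u w - affine_payoff d Q x u' w'| <= eta * \sum_i `|x i| + omega.
Proof.
move=> de Qo; rewrite /affine_payoff opprD addrACA -sumrB mulr_sumr.
apply: (le_trans (ler_normD _ _)); apply: lerD => //.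
apply: (le_trans (ler_norm_sum _ _ _)); apply: ler_sum => i _.
by rewrite -mulrBr normrM mulrC ler_wpM2r.
Qed.

Lemma jet_bound_lipschitz (K B2 B3 : R) (g : R -> R) : jet_bound K B2 B3 g ->
  forall x y, `|g x - g y| <= K * `|x - y|.
Proof.
move=> [g1 [g2 [g3 [gj gB]]]] x y.
apply: (@derive_bound_lipschitz _ _ g1); first by move=> z; have [] := gj z.
by move=> z _; have [] := gB z.
Qed.

Lemma l1_lipschitz_maxmin (U W : Type) (Su : set U) (Sw : set W)
    (d : I -> U -> W -> R) (Q : U -> W -> R) (D : R) : 0 <= D ->
  (forall i u w, Su u -> Sw w -> `|d i u w| <= D) ->
  l1_lipschitz D (fun x => maxmin Su Sw (affine_payoff d Q x)).
Proof.
move=> D0 dD x y; apply: maxmin_dist.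
  by rewrite mulr_ge0// sumr_ge0.
by move=> u w Suu Sww; apply: affine_payoff_dist => i; exact: dD.
Qed.

Lemma l1_lipschitz_comp (K D : R) (g : R -> R) (F : (I -> R) -> R) : 0 <= K ->
  (forall x y, `|g x - g y| <= K * `|x - y|) ->
  l1_lipschitz D F -> l1_lipschitz (K * D) (fun x => g (F x)).
Proof.
move=> K0 gK FD x y; apply: (le_trans (gK _ _)).
by rewrite -mulrA ler_wpM2l.
Qed.

Section soft.
Variables (U W : finType) (u0 : U) (w0 : W) (d : I -> U -> W -> R) (Q : U -> W -> R).
Variables (D K beta : R) (g : R -> R).
Hypothesis beta0 : 0 < beta.
Hypothesis dD : forall i u w, `|d i u w| <= D.
Hypothesis gK : jet_bound K K K g.

Let h x := g (soft_maxmin beta (affine_payoff d Q x)).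

(** Along one coordinate the payoff is [c + a * d k] with [|d k| <= D], so [taylor3] applies to the
    composition with [g]. The value of [D'] may stay unspecified, since [lindeberg] does not retain
    it. *)
Lemma third_order_expansion_soft_maxmin : exists D',
  third_order_expansion D' (K * (D ^+ 3 + 3 * (D * (4 * beta * D ^+ 2)) + 24 * beta ^+ 2 * D ^+ 3)) h.
Proof.
set B1 := K * D; set B2 := K * (D ^+ 2 + 4 * beta * D ^+ 2); exists (Num.max B1 (B2 / 2)).
move=> k x.
have hE a : h (upd x k a) =
    g (soft_maxmin beta (fun u w => affine_payoff d Q (upd x k 0) u w + a * d k u w)).
  congr (g (soft_maxmin _ _)); apply/funext => u; apply/funext => w.
  rewrite /affine_payoff addrAC; congr (_ + _).
  rewrite (bigD1 k)//= [in RHS](bigD1 k)//= /upd eqxx mul0r add0r addrC; congr (_ + _).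
  by apply: eq_bigr => i /negbTE ->.
have [p1 [p2 [p1B p2B pE]]] := taylor3 (jet_bound_comp gK
  (jet_bound_soft_maxmin u0 w0 beta0 (affine_payoff d Q (upd x k 0)) (dD k))).
exists p1, p2; split; rewrite ?le_max ?p1B ?p2B ?orbT// => a.
by have := pE a; rewrite /= -hE -(hE 0).
Qed.

Lemma l1_lipschitz_soft_maxmin : 0 <= K -> l1_lipschitz (K * D) h.
Proof.
move=> K0; apply: l1_lipschitz_comp => //; first exact: jet_bound_lipschitz gK.
move=> x y; apply: (soft_maxmin_dist u0 w0 beta0) => u w.
by apply: affine_payoff_dist => i; exact: dD.
Qed.
End soft.

End affine_payoff.

(** * Comparison of expectations through the soft max-min *)

Lemma dist_Rintegral_le (R : realType) d (T : measurableType d) (P : probability T R)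
    (f1 f2 f : T -> R) :
  P.-integrable setT (EFin \o f1) -> P.-integrable setT (EFin \o f2) ->
  P.-integrable setT (EFin \o f) -> (forall t, `|f1 t - f2 t| <= f t) ->
  `|\int[P]_t f1 t - \int[P]_t f2 t| <= \int[P]_t f t.
Proof.
move=> i1 i2 i3 H; rewrite -RintegralB//.
have i12 : P.-integrable setT (EFin \o (fun t => f1 t - f2 t)).
  have := integrableB measurableT i1 i2; congr (integrable _ _ _).
apply: (le_trans (le_normr_Rintegral measurableT i12)).
by apply: le_Rintegral => //; exact: (integrable_norm i12).
Qed.

Lemma Rintegral_probability_cst (R : realType) d (T : measurableType d) (P : probability T R) (r : R) :
  \int[P]_t r = r.
Proof.
rewrite Rintegral_cst// [X in fine X](_ : _ = 1%E) ?mulr1//; exact: probability_setT.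
Qed.

Lemma Rintegral_sum (R : realType) d (T : measurableType d) (P : probability T R)
    (I : finType) (f : I -> T -> R) :
  (forall i, P.-integrable setT (EFin \o f i)) ->
  P.-integrable setT (EFin \o (fun t => \sum_i f i t)) /\
  \int[P]_t (\sum_i f i t) = \sum_i \int[P]_t f i t.
Proof.
move=> fi; elim: (index_enum I) => [|i s [IH1 IH2]].
  under eq_fun do rewrite big_nil; rewrite big_nil Rintegral_cst// mul0r; split => //.
  exact: finite_measure_integrable_cst.
under eq_fun do rewrite big_cons; rewrite big_cons -IH2 -RintegralD//; split => //.
  have := integrableD measurableT (fi i) IH1; congr (integrable _ _ _).
Qed.

Section single.
Context (R : realType) (I : finType) d (T : measurableType d) (P : probability T R).
Variable X : I -> {RV P >-> R}.
Hypothesis iX : forall i, P.-integrable setT (fun t => (`|X i t|)%:E).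

(** The discretization error is random: moving a vector to its net point costs up to
    [eta * \sum_i |X i| + omega]. Its expectation produces the first-moment term of the bound. *)
Lemma soft_approximation (U W : Type) (Su : set U) (Sw : set W)
    (JU JW : finType) (u0 : JU) (w0 : JW) (ru : JU -> U) (rw : JW -> W)
    (cu : U -> JU) (cw : W -> JW) (dd : I -> U -> W -> R) (Q : U -> W -> R)
    (D K beta eta omega : R) (g : R -> R) :
  0 < beta -> 0 <= D -> 0 <= K ->
  (forall x, `|g x| <= K) -> jet_bound K K K g ->
  (forall c, Su (ru c)) -> (forall c, Sw (rw c)) ->
  (forall i u w, Su u -> Sw w -> `|dd i u w| <= D) ->
  (forall i u w, Su u -> Sw w -> `|dd i u w - dd i (ru (cu u)) w| <= eta) ->
  (forall i u w, Su u -> Sw w -> `|dd i u w - dd i u (rw (cw w))| <= eta) ->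
  (forall u w, Su u -> Sw w -> `|Q u w - Q (ru (cu u)) w| <= omega) ->
  (forall u w, Su u -> Sw w -> `|Q u w - Q u (rw (cw w))| <= omega) ->
  `|\int[P]_t g (maxmin Su Sw (affine_payoff dd Q (fun i => X i t))) -
    \int[P]_t g (soft_maxmin beta (affine_payoff (fun i c c' => dd i (ru c) (rw c'))
      (fun c c' => Q (ru c) (rw c')) (fun i => X i t)))| <=
  K * (eta * \sum_i \int[P]_t `|X i t| + omega + beta^-1 * (ln #|JU|%:R + ln #|JW|%:R)).
Proof.
move=> beta0 D0 K0 gK gj Sru Srw dD du dw Qu Qw.
have gL := jet_bound_lipschitz gj.
set ell := beta^-1 * _.
have [iS ES] := Rintegral_sum (f := fun i t => `|X i t|) iX.
have iE : P.-integrable setT (EFin \o (fun t => eta * \sum_i `|X i t|)).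
  have := integrableZl measurableT eta iS; congr (integrable _ _ _).
have iE2 : P.-integrable setT (EFin \o (fun t => eta * \sum_i `|X i t| + (omega + ell))).
  have := integrableD measurableT iE (finite_measure_integrable_cst P (omega + ell) measurableT).
  congr (integrable _ _ _).
have -> : eta * \sum_i \int[P]_t `|X i t| + omega + ell =
    \int[P]_t (eta * \sum_i `|X i t| + (omega + ell)).
  rewrite RintegralD//; last exact: finite_measure_integrable_cst.
  by rewrite RintegralZl// ES Rintegral_probability_cst -addrA.
rewrite -RintegralZl//; apply: dist_Rintegral_le.
- apply: (@bounded_integrable _ _ _ P _ K) => //.
  apply: (measurable_l1_lipschitz X (C := K * D)
    (h := fun x => g (maxmin Su Sw (affine_payoff dd Q x)))).
  by apply: l1_lipschitz_comp => //; exact: l1_lipschitz_maxmin.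
- apply: (@bounded_integrable _ _ _ P _ K) => //.
  apply: (measurable_l1_lipschitz X (C := K * D)
    (h := fun x => g (soft_maxmin beta (affine_payoff (fun i c c' => dd i (ru c) (rw c'))
      (fun c c' => Q (ru c) (rw c')) x)))).
  by apply: l1_lipschitz_soft_maxmin => // i u w; exact: dD.
- have := integrableZl measurableT K iE2; congr (integrable _ _ _).
move=> t; apply: (le_trans (gL _ _)); rewrite ler_wpM2l// addrA.
apply: (maxmin_soft_maxmin u0 w0 beta0 Sru Srw) => u w Suu Sww.
  by apply: affine_payoff_move => [i|]; [exact: du|exact: Qu].
by apply: affine_payoff_move => [i|]; [exact: dw|exact: Qw].
Qed.
End single.

Section core.
Context (R : realType) (I : finType).
Context dA (TA : measurableType dA) (PA : probability TA R).
Context dB (TB : measurableType dB) (PB : probability TB R).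
Variables (A : I -> {RV PA >-> R}) (B : I -> {RV PB >-> R}).
Hypothesis indA : independent_family A.
Hypothesis indB : independent_family B.
Hypothesis iA : forall i l, (1 <= l <= 3)%N -> PA.-integrable setT (fun t => (`|A i t| ^+ l)%:E).
Hypothesis iB : forall i l, (1 <= l <= 3)%N -> PB.-integrable setT (fun t => (`|B i t| ^+ l)%:E).
Hypothesis mAB : forall i l, (1 <= l <= 2)%N -> \int[PA]_t (A i t) ^+ l = \int[PB]_t (B i t) ^+ l.

Lemma maxmin_comparison (U W : Type) (Su : set U) (Sw : set W)
    (JU JW : finType) (u0 : JU) (w0 : JW) (ru : JU -> U) (rw : JW -> W)
    (cu : U -> JU) (cw : W -> JW) (dd : I -> U -> W -> R) (Q : U -> W -> R)
    (D K beta eta omega : R) (g : R -> R) :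
  1 <= beta -> 0 <= D -> 0 <= K ->
  (forall x, `|g x| <= K) -> jet_bound K K K g ->
  (forall c, Su (ru c)) -> (forall c, Sw (rw c)) ->
  (forall i u w, Su u -> Sw w -> `|dd i u w| <= D) ->
  (forall i u w, Su u -> Sw w -> `|dd i u w - dd i (ru (cu u)) w| <= eta) ->
  (forall i u w, Su u -> Sw w -> `|dd i u w - dd i u (rw (cw w))| <= eta) ->
  (forall u w, Su u -> Sw w -> `|Q u w - Q (ru (cu u)) w| <= omega) ->
  (forall u w, Su u -> Sw w -> `|Q u w - Q u (rw (cw w))| <= omega) ->
  `|\int[PA]_t g (maxmin Su Sw (affine_payoff dd Q (fun i => A i t))) -
    \int[PB]_t g (maxmin Su Sw (affine_payoff dd Q (fun i => B i t)))| <=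
  K * (eta * \sum_i (\int[PA]_t `|A i t| + \int[PB]_t `|B i t|) + 2 * omega
    + 2 * (beta^-1 * (ln #|JU|%:R + ln #|JW|%:R))
    + 37 * beta ^+ 2 * D ^+ 3 * \sum_i (\int[PA]_t `|A i t| ^+ 3 + \int[PB]_t `|B i t| ^+ 3)).
Proof.
move=> beta1 D0 K0 gK gj Sru Srw dD du dw Qu Qw.
have beta0 : 0 < beta by exact: lt_le_trans beta1.
have iA1 i : PA.-integrable setT (fun t => (`|A i t|)%:E) by exact: (iA i (l := 1)).
have iB1 i : PB.-integrable setT (fun t => (`|B i t|)%:E) by exact: (iB i (l := 1)).
have sA := soft_approximation iA1 u0 w0 beta0 D0 K0 gK gj Sru Srw dD du dw Qu Qw.
have sB := soft_approximation iB1 u0 w0 beta0 D0 K0 gK gj Sru Srw dD du dw Qu Qw.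
have dD' i u w : `|dd i (ru u) (rw w)| <= D by exact: dD.
have [D' hT] := third_order_expansion_soft_maxmin u0 w0 (fun c c' => Q (ru c) (rw c')) beta0 dD' gj.
have hL := l1_lipschitz_soft_maxmin u0 w0 (fun c c' => Q (ru c) (rw c')) beta0 dD' gj K0.
pose M3 := \sum_i (\int[PA]_t `|A i t| ^+ 3 + \int[PB]_t `|B i t| ^+ 3).
have M30 : 0 <= M3.
  by apply: sumr_ge0 => i _; apply: addr_ge0; apply: Rintegral_ge0 => t _; exact: exprn_ge0.
have D30 : 0 <= D ^+ 3 by exact: exprn_ge0.
(* Since [1 <= beta], the coefficient [1 + 12 beta + 24 beta^2] is at most [37 beta^2]. *)
have cb : D ^+ 3 + 3 * (D * (4 * beta * D ^+ 2)) + 24 * beta ^+ 2 * D ^+ 3 <=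
    37 * beta ^+ 2 * D ^+ 3.
  rewrite (_ : _ + _ = (1 + 12 * beta + 24 * beta ^+ 2) * D ^+ 3); last by ring.
  by rewrite ler_wpM2r//; nra.
set c := (_ + _ + _) in cb hT.
have c0 : 0 <= K * c.
  rewrite mulr_ge0// /c !addr_ge0// ?mulr_ge0// ?exprn_ge0// ?ltW//.
have l13 l : (1 <= l <= 2)%N -> (1 <= l <= 3)%N.
  by case/andP => -> /leq_trans ->.
have := lindeberg indA indB (fun i => iA i (l := 3) isT) (fun i => iB i (l := 3) isT)
  (fun i l l12 => And3 (iA i (l13 l l12)) (iB i (l13 l l12)) (mAB i l12))
  c0 hL (fun x => gK _) hT.
rewrite -/M3 => hAB.
have cM : K * c * M3 <= K * (37 * beta ^+ 2 * D ^+ 3 * M3).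
  by rewrite -mulrA ler_wpM2l// ler_wpM2r.
move: sA sB hAB.
set a1 := \int[PA]_t _; set a2 := \int[PA]_t _.
set b1 := \int[PB]_t _; set b2 := \int[PB]_t _.
move=> sA sB hAB; rewrite big_split/=.
have := ler_distD a2 a1 b1; have := ler_distD b2 a2 b1.
rewrite [`|b2 - b1|]distrC; move: sA sB hAB cM.
set SA := \sum_i \int[PA]_t `|A i t|; set SB := \sum_i \int[PB]_t `|B i t|.
set Z := 37 * _ * _ * _; set ell := beta^-1 * _.
move: `|a1 - a2| `|b1 - b2| `|a2 - b2| `|a2 - b1| `|a1 - b1| (K * c * M3) => *.
have -> : K * (eta * (SA + SB) + 2 * omega + 2 * ell + Z) =
  K * (eta * SA + omega + ell) + K * (eta * SB + omega + ell) + K * Z by ring.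
lra.
Qed.
End core.

(** * Nets of cubes *)

Lemma norm_cV_le (R : realType) m (u : 'cV[R]_m) (e : R) : 0 <= e ->
  (forall i, `|u i ord0| <= e) -> `|u| <= e.
Proof.
move=> e0 ue; rewrite [leLHS]/Num.Def.normr /= mx_normrE; apply: bigmax_le => // -[i j] _ /=.
by rewrite ord1.
Qed.

Lemma coord_norm_cV (R : realType) m (u : 'cV[R]_m) i : `|u i ord0| <= `|u|.
Proof.
rewrite [leRHS]/Num.Def.normr /= mx_normrE.
exact: (le_bigmax _ (fun ij : 'I_m * 'I_1 => `|u ij.1 ij.2|) (i, ord0)).
Qed.

(** The cube is cut into cells of side [delta], at most [k + 1] per axis, and each cell that meets
    [S] is represented by a point of [S] itself; cells missing [S] receive the default [u0]. Thus
    the net stays inside [S], and two points of one cell differ by at most [delta] in each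
    coordinate. *)
Lemma cube_net (R : realType) m (S : set 'cV[R]_m) (u0 : 'cV[R]_m) (l delta : R) :
  0 <= l -> 0 < delta -> S u0 -> (forall u, S u -> forall i, - l <= u i ord0 <= l) ->
  exists k (r : {ffun 'I_m -> 'I_k.+1} -> 'cV[R]_m) (c : 'cV[R]_m -> {ffun 'I_m -> 'I_k.+1}),
    [/\ k%:R <= 2 * l / delta, forall z, S (r z) & forall u, S u -> `|u - r (c u)| <= delta].
Proof.
move=> l0 d0 Su0 Sl; pose k := Num.truncn (2 * l / delta).
have ld0 : 0 <= 2 * l / delta by rewrite divr_ge0 ?mulr_ge0// ltW.
pose t (u : 'cV[R]_m) i := (u i ord0 + l) / delta.
have t0 u i : S u -> 0 <= t u i.
  by move=> /Sl /(_ i) /andP[ul _]; apply: divr_ge0; [lra|exact: ltW].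
have tk u i : S u -> (Num.truncn (t u i) < k.+1)%N.
  move=> Su; rewrite ltnS le_truncn// ler_pM2r ?invr_gt0//.
  by have /andP[_] := Sl u Su i; lra.
pose c (u : 'cV[R]_m) : {ffun 'I_m -> 'I_k.+1} := [ffun i => inord (Num.truncn (t u i))].
pose r z := xget u0 [set u | S u /\ c u = z].
exists k, r, c; split.
- by rewrite truncn_le.
- by move=> z; rewrite /r; case: xgetP => [u _ []|].
move=> u Su; have [Sr cr] : S (r (c u)) /\ c (r (c u)) = c u.
  by rewrite /r; case: xgetP => [//|/(_ u)]; case.
apply: norm_cV_le => [|i]; first exact: ltW.
move/ffunP/(_ i)/(congr1 val): cr; rewrite !ffunE /= !inordK ?tk//.
rewrite !mxE; move: (r (c u)) Sr => v Sv tE.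
have /andP[v1 v2] := truncn_itv (t0 v i Sv); have /andP[u1 u2] := truncn_itv (t0 u i Su).
rewrite tE -natr1 in v1 v2; rewrite -natr1 in u2.
have : `|t u i - t v i| <= 1 by rewrite ler_norml; apply/andP; split; lra.
rewrite /t -mulrBl normrM normfV (gtr0_norm d0) ler_pdivrMr// mul1r.
by rewrite opprD addrACA subrr addr0.
Qed.

(** * The comparison bound *)

Lemma maxmin_empty (R : realType) (U W : Type) (Su : set U) (Sw : set W) (X X' : U -> W -> R) :
  Su = set0 \/ Sw = set0 -> maxmin Su Sw X = maxmin Su Sw X'.
Proof.
rewrite /maxmin => -[->|->]; first by rewrite !image_set0.
have E (Y : U -> W -> R) : (fun u => ereal_inf [set (Y u w)%:E | w in set0]) = fun=> ereal_inf set0.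
  by apply/funext => u; rewrite image_set0.
by rewrite !E.
Qed.

(** The factor 3 comes from [k + 1 <= 2 y + 1 <= y^3] for [y >= 2]. *)
Lemma log_plus_net (R : realType) (k : nat) (l y : R) : 2 <= y -> l <= y -> k%:R <= 2 * l ->
  ln k.+1%:R <= 3 * log_plus y.
Proof.
move=> y2 ly kl; have y0 : 0 < y by lra.
apply: (@le_trans _ _ (ln (y ^+ 3))).
  rewrite ler_ln ?posrE ?exprn_gt0//.
  rewrite -natr1; nra.
by rewrite lnXn// mulr_natl lerMn2r /log_plus le_max lexx orbT.
Qed.

(** This [beta] equates the smoothing error [N / beta] with the replacement error [beta^2 L^6 M3].
    The last clause holds because [Theta = N / beta] and [N >= 1]. *)
Lemma optimal_temperature (R : realType) (N M3 L : R) : 1 <= N -> 0 < M3 -> 1 <= L ->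
  let Theta := N `^ (2 / 3) * M3 `^ (1 / 3) * L ^+ 2 in
  let beta := N `^ (1 / 3) / (M3 `^ (1 / 3) * L ^+ 2) in
  [/\ 0 < beta, beta^-1 * N = Theta, beta ^+ 2 * (L ^+ 2) ^+ 3 * M3 = Theta &
      beta < 1 -> 1 <= Theta].
Proof.
move=> N1 M30 L1 Theta beta; set a := N `^ (1 / 3) in beta *; set b := M3 `^ (1 / 3) in Theta beta *.
have N0 : 0 < N by lra.
have a1 : 1 <= a by rewrite /a -[leLHS](powRr0 N) ler_powR//; lra.
have b0 : 0 < b by exact: powR_gt0.
have a3 : N = a ^+ 3.
  by rewrite /a -powR_mulrn ?powR_ge0// -powRrM (_ : 1 / 3 * 3%:R = 1); [rewrite powRr1// ltW|lra].
have b3 : M3 = b ^+ 3.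
  by rewrite /b -powR_mulrn ?powR_ge0// -powRrM (_ : 1 / 3 * 3%:R = 1); [rewrite powRr1// ltW|lra].
have TE : Theta = a ^+ 2 * b * L ^+ 2.
  rewrite /Theta /a -[(N `^ (1 / 3)) ^+ 2]powR_mulrn ?powR_ge0// -powRrM.
  by rewrite (_ : 1 / 3 * 2%:R = 2 / 3)//; lra.
have a0 : a != 0 by rewrite gt_eqF//; lra.
have b0' : b != 0 by rewrite gt_eqF.
have L0 : L != 0 by rewrite gt_eqF//; lra.
have beta0 : 0 < beta.
  by apply: divr_gt0; [lra|apply: mulr_gt0 => //; apply: exprn_gt0; lra].
have bN : beta^-1 * N = Theta.
  by rewrite TE a3 /beta; field; rewrite a0 b0' L0.
split => //.
- by rewrite TE b3 /beta; field; rewrite b0' L0.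
- move=> b1; rewrite -bN -[1]mulr1; apply: ler_pM => //.
  by rewrite invf_ge1// ltW.
Qed.

Section bounded_case.
Context (R : realType) (m n : nat).
Context dA (TA : measurableType dA) (PA : probability TA R).
Context dB (TB : measurableType dB) (PB : probability TB R).
Local Notation I := ('I_m * 'I_n)%type.
Variables (A : I -> {RV PA >-> R}) (B : I -> {RV PB >-> R}).

(* [s = 1] gives the payoff itself; [s = -1] its opposite, through which min-max reduces to
   max-min. *)
Definition signed_bilinear (s : R) (ij : I) (u : 'cV[R]_m) (w : 'cV[R]_n) : R :=
  s * (u ij.1 ord0 * w ij.2 ord0).

Lemma signed_maxmin_comparison (s L Lu Lw delta omega K : R) (Q : 'cV[R]_m -> 'cV[R]_n -> R)
    (Su : set 'cV[R]_m) (Sw : set 'cV[R]_n) (g : R -> R) :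
  independent_family A -> independent_family B ->
  (forall i l, (1 <= l <= 3)%N -> PA.-integrable setT (fun t => (`|A i t| ^+ l)%:E)) ->
  (forall i l, (1 <= l <= 3)%N -> PB.-integrable setT (fun t => (`|B i t| ^+ l)%:E)) ->
  (forall i l, (1 <= l <= 2)%N -> \int[PA]_t (A i t) ^+ l = \int[PB]_t (B i t) ^+ l) ->
  `|s| = 1 -> 1 <= Lu -> 1 <= Lw -> L = Lu + Lw -> 0 < delta < 1 ->
  (forall u, Su u -> forall i, - Lu <= u i ord0 <= Lu) ->
  (forall w, Sw w -> forall j, - Lw <= w j ord0 <= Lw) ->
  (forall u u' w w', `|u| <= L -> `|u'| <= L -> `|w| <= L -> `|w'| <= L ->
     `|u - u'| <= delta -> `|w - w'| <= delta -> `|Q u w - Q u' w'| <= omega) ->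
  1 <= K -> (forall x, `|g x| <= K) -> jet_bound K K K g ->
  let M l := \sum_i (\int[PA]_t `|A i t| ^+ l + \int[PB]_t `|B i t| ^+ l) in
  0 < M 3 ->
  `|\int[PA]_t g (maxmin Su Sw (affine_payoff (signed_bilinear s)
        (fun u w => s * Q u w) (fun i => A i t))) -
    \int[PB]_t g (maxmin Su Sw (affine_payoff (signed_bilinear s)
        (fun u w => s * Q u w) (fun i => B i t)))| <=
  43 * K * (M 1 * (L * delta) + omega +
    log_plus (L / delta) `^ (2 / 3) * (m + n)%:R `^ (2 / 3) * M 3 `^ (1 / 3) * L ^+ 2).
Proof.
move=> indA indB iA iB mAB s1 Lu1 Lw1 LE /andP[d0 d1] SuL SwL Qo K1 gK gj M M30.
have L2 : 2 <= L by lra.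
have M10 : 0 <= M 1%N.
  by apply: sumr_ge0 => i _; apply: addr_ge0; apply: Rintegral_ge0 => t _; exact: exprn_ge0.
have K0 : 0 <= K by lra.
have o0 : 0 <= omega.
  apply: (le_trans (normr_ge0 _) (Qo 0 0 0 0 _ _ _ _ _ _)); rewrite ?subrr normr0; lra.
set ell := log_plus (L / delta).
have ell1 : 1 <= ell by rewrite /ell /log_plus le_max lexx.
(* A positive third moment requires at least one entry, so the dimensions are not zero. *)
have mn1 : 1 <= (m + n)%:R :> R.
  rewrite ler1n lt0n; apply/negP => /eqP mn0; move: M30; rewrite /M big1 ?ltxx// => -[i j] _.
  by exfalso; move/eqP: mn0; rewrite addn_eq0 => /andP[/eqP m0 _]; move: i; rewrite m0 => -[].
have N1 : 1 <= ell * (m + n)%:R by exact: mulr_ege1.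
have L1 : 1 <= L by lra.
have := optimal_temperature N1 M30 L1.
rewrite powRM ?(le_trans ler01)//.
set Theta := _ * L ^+ 2; set beta := _ / (_ * L ^+ 2) => -[beta0 bN bM bT].
have Theta0 : 0 <= Theta by rewrite -bN; apply: mulr_ge0; [rewrite invr_ge0 ltW|lra].
have rhs : K * Theta <= K * (M 1%N * (L * delta) + omega + Theta).
  by rewrite ler_wpM2l// lerDr addr_ge0// !mulr_ge0//; lra.
have rhs0 : 0 <= K * Theta by exact: mulr_ge0.
(* An empty set has no net point to serve as default; the max-min is then independent of the payoff
   and the two expectations agree. *)
have [Su0|/set0P[u0 Su0]] := eqVneq Su set0.
  under eq_Rintegral do rewrite (maxmin_empty _ (fun _ _ => 0) (or_introl Su0)).
  under [X in _ - X]eq_Rintegral do rewrite (maxmin_empty _ (fun _ _ => 0) (or_introl Su0)).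
  rewrite !Rintegral_probability_cst subrr normr0.
  by rewrite -mulrA mulr_ge0//; lra.
have [Sw0|/set0P[w0 Sw0]] := eqVneq Sw set0.
  under eq_Rintegral do rewrite (maxmin_empty _ (fun _ _ => 0) (or_intror Sw0)).
  under [X in _ - X]eq_Rintegral do rewrite (maxmin_empty _ (fun _ _ => 0) (or_intror Sw0)).
  rewrite !Rintegral_probability_cst subrr normr0.
  by rewrite -mulrA mulr_ge0//; lra.
have ds0 : 0 <= L ^+ 2 by apply: exprn_ge0; lra.
have sd u w ij (c c' : R) : `|u| <= c -> `|w| <= c' -> `|s * (u * w)| <= c * c'.
  by move=> uc wc; rewrite normrM s1 mul1r normrM ler_pM.
have SuN u i : Su u -> `|u i ord0| <= Lu by move=> Suu; rewrite ler_norml SuL.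
have SwN w j : Sw w -> `|w j ord0| <= Lw by move=> Sww; rewrite ler_norml SwL.
have SuNL u : Su u -> `|u| <= L.
  by move=> Suu; apply: norm_cV_le => [|i]; [lra|rewrite (le_trans (SuN u i Suu))//; lra].
have SwNL w : Sw w -> `|w| <= L.
  by move=> Sww; apply: norm_cV_le => [|i]; [lra|rewrite (le_trans (SwN w i Sww))//; lra].
have dD ij u w : Su u -> Sw w -> `|signed_bilinear s ij u w| <= L ^+ 2.
  move=> Suu Sww; rewrite normrM s1 mul1r normrM expr2.
  by apply: ler_pM => //; [apply: (le_trans (SuN _ _ Suu))|apply: (le_trans (SwN _ _ Sww))]; lra.
(* When [beta < 1], [Theta >= 1] and each expectation is at most [K] in absolute value, so the
   difference is at most [2 K Theta]. *)
have [b1|b1] := leP 1 beta; last first.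
  have iX d (T : measurableType d) (P : probability T R) (X : I -> {RV P >-> R}) :
      `|\int[P]_t g (maxmin Su Sw (affine_payoff (signed_bilinear s)
        (fun u w => s * Q u w) (fun i => X i t)))| <= K.
    have mg : measurable_fun setT (fun t => g (maxmin Su Sw (affine_payoff (signed_bilinear s)
        (fun u w => s * Q u w) (fun i => X i t)))).
      apply: (measurable_l1_lipschitz X (C := K * L ^+ 2)
        (h := fun x => g (maxmin Su Sw (affine_payoff (signed_bilinear s) (fun u w => s * Q u w) x)))).
      apply: l1_lipschitz_comp => //; first exact: jet_bound_lipschitz gj.
      exact: l1_lipschitz_maxmin.
    have ig := @bounded_integrable _ _ _ P _ K mg (fun t => gK _).
    apply: (le_trans (le_normr_Rintegral measurableT ig)).
    rewrite -[leRHS](Rintegral_probability_cst P).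
    apply: le_Rintegral => //; first exact: (integrable_norm ig).
    exact: finite_measure_integrable_cst.
  apply: (le_trans (ler_normB _ _)); apply: (le_trans (lerD (iX _ _ _ _) (iX _ _ _ _))).
  have KT : K * 1 <= K * Theta by rewrite ler_wpM2l// bT.
  by rewrite -mulrA; lra.
(* [log_plus_net] asks for [2 <= L / delta], which follows from [L = Lu + Lw >= 2] and
   [delta < 1]. *)
have y2 : 2 <= L / delta by rewrite ler_pdivlMr//; nra.
have [ku [ru [cu [kuL Sru ruc]]]] := cube_net (le_trans ler01 Lu1) d0 Su0 SuL.
have [kw [rw [cw [kwL Srw rwc]]]] := cube_net (le_trans ler01 Lw1) d0 Sw0 SwL.
have lnu : ln ku.+1%:R <= 3 * ell.
  apply: (@log_plus_net _ _ (Lu / delta)) => //; last by rewrite mulrA.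
  by rewrite ler_pM2r ?invr_gt0//; lra.
have lnw : ln kw.+1%:R <= 3 * ell.
  apply: (@log_plus_net _ _ (Lw / delta)) => //; last by rewrite mulrA.
  by rewrite ler_pM2r ?invr_gt0//; lra.
have := @maxmin_comparison R I _ _ PA _ _ PB A B indA indB iA iB mAB _ _ Su Sw _ _
  (cu u0) (cw w0) ru rw cu cw (signed_bilinear s) (fun u w => s * Q u w)
  (L ^+ 2) K beta (L * delta) omega g b1 ds0 K0 gK gj Sru Srw dD.
move=> H; apply: (le_trans (H _ _ _ _)).
- move=> i u w Suu Sww; rewrite /signed_bilinear -mulrBr -mulrBl normrM s1 mul1r normrM mulrC.
  apply: ler_pM => //; first by apply: (le_trans (SwN _ _ Sww)); lra.
  by have := coord_norm_cV (u - ru (cu u)) i.1; rewrite !mxE => /le_trans; apply; exact: ruc.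
- move=> i u w Suu Sww; rewrite /signed_bilinear -mulrBr -mulrBr normrM s1 mul1r normrM.
  apply: ler_pM => //; first by apply: (le_trans (SuN _ _ Suu)); lra.
  by have := coord_norm_cV (w - rw (cw w)) i.2; rewrite !mxE => /le_trans; apply; exact: rwc.
- move=> u w Suu Sww; rewrite -mulrBr normrM s1 mul1r.
  by apply: Qo; rewrite ?SuNL ?SwNL ?ruc// subrr normr0 ltW.
- move=> u w Suu Sww; rewrite -mulrBr normrM s1 mul1r.
  by apply: Qo; rewrite ?SuNL ?SwNL ?rwc// subrr normr0 ltW.
rewrite !card_ffun !card_ord !natrX !lnXn ?ltr0n// -![ln _ *+ _]mulr_natr.
have M1E : \sum_i (\int[PA]_t `|A i t| + \int[PB]_t `|B i t|) = M 1%N by [].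
rewrite M1E -/(M 3) -/Theta [43 * K]mulrC -[leRHS]mulrA ler_wpM2l//.
(* The nets have [(ku + 1)^m] and [(kw + 1)^n] points, so their log-cardinalities add up to at most
   [3 ell (m + n)]. This term occurs twice, which together with 37 gives the constant 43. *)
have T1 : beta^-1 * (ln ku.+1%:R * m%:R + ln kw.+1%:R * n%:R) <= 3 * Theta.
  rewrite -bN mulrCA ler_pM2l ?invr_gt0// natrD mulrDr mulrDr.
  by rewrite lerD// mulrA ler_wpM2r.
have T2 : 37 * beta ^+ 2 * (L ^+ 2) ^+ 3 * M 3%N = 37 * Theta by rewrite -bM; ring.
have T3 : 0 <= M 1%N * (L * delta).
  by rewrite mulr_ge0// mulr_ge0// ltW// (lt_le_trans _ L1).
by rewrite T2; clear -T3 T1 o0 Theta0; lra.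
Qed.
End bounded_case.

(** * Absolute moments and almost surely vanishing entries *)

Section absolute_moments.
Context (R : realType) d (T : measurableType d) (P : probability T R).
Implicit Type X : {RV P >-> R}.

Lemma expectationE (f : T -> R) : ('E_P[f] = \int[P]_t (f t)%:E)%E.
Proof. by rewrite unlock. Qed.

Lemma expectation_absX_ge0 X l : (0 <= 'E_P[fun t => (`|X t| ^+ l)%R])%E.
Proof. by apply: expectation_ge0 => t; exact: exprn_ge0. Qed.

Lemma integrable_absX X l : ('E_P[fun t => (`|X t| ^+ l)%R] < +oo)%E ->
  P.-integrable setT (fun t => (`|X t| ^+ l)%:E).
Proof.
rewrite expectationE => lty; apply/integrableP; split.
  by apply/measurable_EFinP; apply: measurable_funX; exact: measurableT_comp.
rewrite (eq_integral (fun t => (`|X t| ^+ l)%:E))// => t _.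
by rewrite /= ger0_norm// exprn_ge0.
Qed.

Lemma integrable_absX_le X l k : (l <= k)%N ->
  P.-integrable setT (fun t => (`|X t| ^+ k)%:E) ->
  P.-integrable setT (fun t => (`|X t| ^+ l)%:E).
Proof.
move=> lk ik.
have i1 : P.-integrable setT (fun t => (1 + `|X t| ^+ k)%:E).
  have := integrableD measurableT (finite_measure_integrable_cst P 1 measurableT) ik.
  congr (integrable _ _ _).
apply: (le_integrable _ _ _ i1) => //=.
  by apply/measurable_EFinP; apply: measurable_funX; exact: measurableT_comp.
move=> t _; rewrite lee_fin normrX normr_id [leRHS]ger0_norm ?addr_ge0 ?exprn_ge0//.
have [x1|x1] := leP `|X t| 1.
  by apply: (@le_trans _ _ 1); [rewrite exprn_ile1|rewrite lerDl exprn_ge0].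
by apply: (@le_trans _ _ (`|X t| ^+ k)); [rewrite ler_weXn2l// ltW|rewrite lerDr].
Qed.

Lemma expectation_fin (f : T -> R) : P.-integrable setT (fun t => (f t)%:E) ->
  ('E_P[f] = (\int[P]_t f t)%R%:E)%E.
Proof. by move=> fi; rewrite expectationE /Rintegral fineK//; exact: integrable_fin_num fi. Qed.

Lemma expectation_abs3_eq0 X : ('E_P[fun t => (`|X t| ^+ 3)%R] = 0)%E ->
  {ae P, forall t, X t = 0}.
Proof.
rewrite expectationE => X0.
have mX3 : measurable_fun setT (fun t => (`|X t| ^+ 3)%:E).
  by apply/measurable_EFinP; apply: measurable_funX; exact: measurableT_comp.
have /(ae_eq_integral_abs P measurableT mX3) : (\int[P]_t `|(`|X t| ^+ 3)%:E| = 0)%E.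
  by rewrite -X0; apply: eq_integral => t _; rewrite /= ger0_norm// exprn_ge0.
apply: filterS => t /(_ Logic.I) /= [] /eqP.
by rewrite expf_eq0/= normr_eq0 => /eqP.
Qed.

(** This settles the case [M_3 = 0]: finitely many null sets combine, and the expectation is the
    value at the zero matrix, even for an unbounded [g]. *)
Lemma expectation_null_family (I : finType) (X : I -> {RV P >-> R}) (D : R) (F : (I -> R) -> R)
    (g : R -> R) :
  l1_lipschitz D F -> continuous g -> (forall i, {ae P, forall t, X i t = 0}) ->
  ('E_P[fun t => g (F (fun i => X i t))] = (g (F (fun=> 0%R)))%:E)%E.
Proof.
move=> FD cg X0; rewrite -(expectation_cst P (g (F (fun=> 0)))) !expectationE.
apply: ae_eq_integral => //.
  apply/measurable_EFinP; apply: (measurableT_comp (f := g)).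
    exact: continuous_measurable_fun.
  exact: measurable_l1_lipschitz FD.
  by apply/measurable_EFinP; exact: measurable_cst.
have : {ae P, forall t i, X i t = 0} by exact: filter_forall.

apply: filterS => t Xt _ /=; congr (g (F _))%:E.
exact/funext.
Qed.

End absolute_moments.

(** * The bound in the extended reals *)

Section extended_case.
Context (R : realType) (m n : nat).
Context dA (TA : measurableType dA) (PA : probability TA R).
Context dB (TB : measurableType dB) (PB : probability TB R).
Local Notation I := ('I_m * 'I_n)%type.
Variables (A : I -> {RV PA >-> R}) (B : I -> {RV PB >-> R}).

Lemma modulus_ge0 (Q : 'cV[R]_m -> 'cV[R]_n -> R) (L delta : R) :
  0 <= L -> 0 <= delta -> (0 <= modulus Q L delta)%E.
Proof.
move=> L0 d0; apply: ereal_sup_ubound; exists 0, 0, 0, 0.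
by rewrite !subrr !normr0 maxxx.
Qed.

(** [kappa] is abstract so that the min-max case can keep [Kg g] while the function tested is
    [x -> g (- x)]. *)
Lemma extended_maxmin_comparison (s L Lu Lw : R) (M : nat -> \bar R) (Q : 'cV[R]_m -> 'cV[R]_n -> R)
    (Su : set 'cV[R]_m) (Sw : set 'cV[R]_n) (g : R -> R) (kappa : \bar R) :
  independent_family A -> independent_family B ->
  (forall i l, (1 <= l <= 2)%N ->
    ('E_PA[fun t => (A i t ^+ l)%R] = 'E_PB[fun t => (B i t ^+ l)%R])%E) ->
  `|s| = 1 -> 1 <= Lu -> 1 <= Lw ->
  (forall u, Su u -> forall i, - Lu <= u i ord0 <= Lu) ->
  (forall w, Sw w -> forall j, - Lw <= w j ord0 <= Lw) ->
  continuous g -> (1 <= kappa)%E ->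
  (forall K : R, kappa = K%:E -> (forall x, `|g x| <= K) /\ jet_bound K K K g) ->
  L = Lu + Lw ->
  (forall l, M l = \sum_i ('E_PA[fun t => (`|A i t| ^+ l)%R] + 'E_PB[fun t => (`|B i t| ^+ l)%R]))%E ->
  (`| 'E_PA[fun t => g (maxmin Su Sw (affine_payoff (signed_bilinear s)
          (fun u w => (s * Q u w)%R) (fun i => A i t)))]
    - 'E_PB[fun t => g (maxmin Su Sw (affine_payoff (signed_bilinear s)
          (fun u w => (s * Q u w)%R) (fun i => B i t)))] | <=
   43%:E * kappa * ereal_inf [set M 1%N * (L * delta)%:E + modulus Q L delta
      + (log_plus (L / delta) `^ (2 / 3) * (m + n)%:R `^ (2 / 3))%:E
        * poweR (M 3%N) (1 / 3) * (L ^+ 2)%:E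
      | delta in [set delta : R | (0 < delta < 1)%R]])%E.
Proof.
move=> indA indB mAB s1 Lu1 Lw1 SuL SwL cg kappa1 gkappa LE MS.
have L2 : 2 <= L by rewrite LE; lra.
have kappa0 : (0 < kappa)%E by exact: lt_le_trans kappa1.
have C0 : (0 < 43%:E * kappa)%E by rewrite mule_gt0// lte_fin.
have Ml0 l : (0 <= M l)%E.
  by rewrite MS; apply: sume_ge0 => i _; apply: adde_ge0; exact: expectation_absX_ge0.
pose term1 delta := (M 1%N * (L * delta)%:E + modulus Q L delta)%E.
pose term2 delta := ((log_plus (L / delta) `^ (2 / 3) * (m + n)%:R `^ (2 / 3))%:E
        * poweR (M 3%N) (1 / 3) * (L ^+ 2)%:E)%E.
have t10 delta : 0 < delta -> (0 <= term1 delta)%E.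
  move=> d0; apply: adde_ge0; first by apply: mule_ge0 => //; rewrite lee_fin mulr_ge0//; lra.
  by apply: modulus_ge0; lra.
have t20 delta : (0 <= term2 delta)%E.
  apply: mule_ge0; first apply: mule_ge0.
  - by rewrite lee_fin mulr_ge0 ?powR_ge0.
  - exact: poweR_ge0.
  - by rewrite lee_fin exprn_ge0//; lra.
have inf0 : (0 <= ereal_inf [set (term1 delta + term2 delta)%E
      | delta in [set delta : R | (0 < delta < 1)%R]])%E.
  apply: le_ereal_inf_tmp => _ [delta /= /andP[d0 _] <-]; apply: adde_ge0 => //.
  exact: t10.
have dD0 ij u w : Su u -> Sw w -> `|signed_bilinear s ij u w| <= Lu * Lw.
  move=> Suu Sww; rewrite normrM s1 mul1r normrM.
  by apply: ler_pM => //; rewrite ler_norml ?SuL ?SwL.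
have Flip := l1_lipschitz_maxmin (fun u w => s * Q u w)
  (mulr_ge0 (le_trans ler01 Lu1) (le_trans ler01 Lw1)) dD0.
have M3i i : ('E_PA[fun t => (`|A i t| ^+ 3)%R] + 'E_PB[fun t => (`|B i t| ^+ 3)%R] <= M 3%N)%E.
  rewrite MS (bigD1 i)//=; apply: leeDl; apply: sume_ge0 => j _.
  by apply: adde_ge0; exact: expectation_absX_ge0.
(* This case must precede the one of infinite [kappa]: if [M 3] vanishes, so may the infimum, and
   then the bound is [+oo * 0 = 0]. *)
have [M30|M3n0] := eqVneq (M 3%N) 0%E.
  have M3i0 i : ('E_PA[fun t => (`|A i t| ^+ 3)%R] = 0 /\ 'E_PB[fun t => (`|B i t| ^+ 3)%R] = 0)%E.
    have a0 := expectation_absX_ge0 (A i) 3; have b0 := expectation_absX_ge0 (B i) 3.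
    have := M3i i; rewrite M30 => ab.
    by split; apply/eqP; rewrite eq_le ?a0 ?b0 andbT (le_trans _ ab)// ?leeDl// leeDr.
  rewrite (expectation_null_family Flip cg (fun i => expectation_abs3_eq0 (M3i0 i).1)).
  rewrite (expectation_null_family Flip cg (fun i => expectation_abs3_eq0 (M3i0 i).2)).
  by rewrite subee// abse0 mule_ge0// ltW.
have M3p : (0 < M 3%N)%E by rewrite lt_neqAle eq_sym M3n0 Ml0.
have mn1 : 1 <= (m + n)%:R :> R.
  rewrite ler1n lt0n; apply/negP; rewrite addn_eq0 => /andP[/eqP m0 _].
  move/eqP: M3n0; apply; rewrite MS; apply: big1 => i _; exfalso.
  by move: i.1; rewrite m0 => -[].
have lp1 x : 1 <= log_plus x by rewrite /log_plus le_max lexx.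
have coef1 delta : 1 <= log_plus (L / delta) `^ (2 / 3) * (m + n)%:R `^ (2 / 3).
  have h (x : R) : 1 <= x -> 1 <= x `^ (2 / 3).
    by move=> x1; rewrite -[leLHS](powRr0 x) ler_powR//; lra.
  by apply: mulr_ege1; apply: h.
have t2p delta : (poweR (M 3%N) (1 / 3) <= term2 delta)%E.
  have p0 := poweR_ge0 (M 3%N) (1 / 3).
  rewrite /term2 -[leLHS]mule1; apply: lee_pmul => //.
    by rewrite -[leLHS]mul1e lee_wpmul2r// lee_fin coef1.
  by rewrite lee_fin expr_ge1//; lra.
have pM3 : (0 < poweR (M 3%N) (1 / 3))%E by exact: poweR_gt0.
(* For infinite [kappa] the right-hand side is [+oo] as soon as the infimum is positive; [t2p]
   bounds it below by the cube root of [M 3], uniformly in [delta]. *)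
have [kfin|] := boolP (kappa \is a fin_num); last first.
  move=> kinf; have -> : kappa = +oo%E.
    by move: kinf kappa0; case: (kappa).
  rewrite gt0_muley// gt0_mulye ?leey//.
  apply: (lt_le_trans pM3); apply: le_ereal_inf_tmp => _ [delta /= /andP[d0 _] <-].
  by apply: (le_trans (t2p delta)); apply: leeDr; exact: t10.
move: (kfin) => /fineK; set K := fine kappa => KE.
have [gK gj] := gkappa K (esym KE).
have K1 : 1 <= K by rewrite -lee_fin KE.
rewrite -KE -EFinM -lee_pdivrMl; last by lra.
apply: le_ereal_inf_tmp => _ [delta /= d01 <-]; have /andP[d0 d1] := d01.
rewrite lee_pdivrMl; last by lra.
have c0 : (0 < (43 * K)%:E)%E by rewrite lte_fin; lra.
(* An infinite third moment, or next an infinite modulus, makes the right-hand side [+oo] at this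
   [delta]. Otherwise finite third moments bring the lower ones with them, and the real-valued bound
   applies. *)
have [M3inf|M3fin] := eqVneq (M 3%N) +oo%E.
  rewrite [X in (_ * X)%E](_ : _ = +oo%E) ?gt0_muley ?leey//.
  apply/eqP; rewrite -leye_eq; apply: (@le_trans _ _ (term2 delta)); last by apply: leeDr; exact: t10.
  apply: (le_trans _ (t2p delta)); rewrite M3inf poweRyr//; lra.
have [minf|mfin] := eqVneq (modulus Q L delta) +oo%E.
  rewrite [X in (_ * X)%E](_ : _ = +oo%E) ?gt0_muley ?leey//.
  rewrite minf addey//; last by rewrite gt_eqF// (lt_le_trans ltNy0)// mule_ge0// lee_fin mulr_ge0//; lra.
  rewrite addye// gt_eqF// (lt_le_trans ltNy0)//; exact: t20.
have M3lt i : ('E_PA[fun t => (`|A i t| ^+ 3)%R] + 'E_PB[fun t => (`|B i t| ^+ 3)%R] < +oo)%E.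
  by apply: (le_lt_trans (M3i i)); rewrite lt_neqAle M3fin leey.
have iA3 i : PA.-integrable setT (fun t => (`|A i t| ^+ 3)%:E).
  apply: integrable_absX; apply: le_lt_trans (M3lt i).
  by apply: leeDl; exact: expectation_absX_ge0.
have iB3 i : PB.-integrable setT (fun t => (`|B i t| ^+ 3)%:E).
  apply: integrable_absX; apply: le_lt_trans (M3lt i).
  by apply: leeDr; exact: expectation_absX_ge0.
have iA i l : (1 <= l <= 3)%N -> PA.-integrable setT (fun t => (`|A i t| ^+ l)%:E).
  by move=> /andP[_ l3]; exact: integrable_absX_le l3 (iA3 i).
have iB i l : (1 <= l <= 3)%N -> PB.-integrable setT (fun t => (`|B i t| ^+ l)%:E).
  by move=> /andP[_ l3]; exact: integrable_absX_le l3 (iB3 i).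
have mABr i l : (1 <= l <= 2)%N -> \int[PA]_t (A i t) ^+ l = \int[PB]_t (B i t) ^+ l.
  by move=> l12; have := mAB i l l12; rewrite !expectationE /Rintegral => ->.
pose Mr l := \sum_i (\int[PA]_t `|A i t| ^+ l + \int[PB]_t `|B i t| ^+ l).
have ME l : (1 <= l <= 3)%N -> M l = (Mr l)%:E.
  move=> l13; rewrite MS /Mr -sumEFin; apply: eq_bigr => i _.
  by rewrite EFinD !expectation_fin//; [exact: iB|exact: iA].
have mod_fin : modulus Q L delta \is a fin_num.
  rewrite ge0_fin_numE ?lt_neqAle ?mfin ?leey//; apply: modulus_ge0; lra.
have Qo u u' w w' : `|u| <= L -> `|u'| <= L -> `|w| <= L -> `|w'| <= L ->
     `|u - u'| <= delta -> `|w - w'| <= delta -> `|Q u w - Q u' w'| <= fine (modulus Q L delta).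
  move=> uL u'L wL w'L uu ww; rewrite -lee_fin fineK//; apply: ereal_sup_ubound.
  by exists u, u', w, w'; split => //; rewrite ge_max uu ww.
have Mr3 : 0 < Mr 3%N by rewrite -lte_fin -ME.
have main := signed_maxmin_comparison indA indB iA iB mABr s1 Lu1 Lw1 LE d01 SuL SwL
  Qo K1 gK gj Mr3.
have gi d (T : measurableType d) (P : probability T R) (X : I -> {RV P >-> R}) :
    P.-integrable setT (fun t => (g (maxmin Su Sw (affine_payoff (signed_bilinear s)
          (fun u w => (s * Q u w)%R) (fun i => X i t))))%:E).
  apply: (@bounded_integrable _ _ _ P _ K) => //.
  apply: (measurableT_comp (f := g)); first exact: continuous_measurable_fun.
  exact: measurable_l1_lipschitz Flip.
rewrite !expectation_fin; try exact: gi.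
rewrite -EFinB abse_EFin !ME// -(fineK mod_fin) poweR_EFin.
by rewrite -lee_fin in main.
Qed.

End extended_case.

(** * Derivative bounds for [g] and the reduction of min-max to max-min *)

Lemma Kg_ge1 (R : realType) (g : R -> R) : (1 <= Kg g)%E.
Proof. by rewrite /Kg leeDl// bigmax_ge_id. Qed.

Lemma le_Kg (R : realType) (g : R -> R) l x : (l < 4)%N -> (`|derive1n l g x|%:E <= Kg g)%E.
Proof.
move=> l4; apply: (@le_trans _ _ (sup_norm (derive1n l g))).
  by apply: ereal_sup_ubound; exists x.
apply: (@le_trans _ _ (\big[maxe/0]_(l < 4) sup_norm (derive1n l g))%E).
  exact: (le_bigmax _ (fun l : 'I_4 => sup_norm (derive1n l g)) (Ordinal l4)).
by rewrite /Kg leeDr.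
Qed.

Lemma C3_continuous (R : realType) (g : R -> R) : C3 g -> continuous g.
Proof.
by move=> [g3 _] x; apply/differentiable_continuous/derivable1_diffP; exact: (g3 0%N x).
Qed.

Lemma C3_jet_bound (R : realType) (g : R -> R) (K : R) : C3 g -> Kg g = K%:E ->
  (forall x, `|g x| <= K) /\ jet_bound K K K g.
Proof.
move=> [g3 _] gK.
have le l x : (l < 4)%N -> `|derive1n l g x| <= K by move=> l4; rewrite -lee_fin -gK le_Kg.
have der l (x : R) : (l < 3)%N -> is_derive x 1 (derive1n l g) (derive1n l.+1 g x).
  by move=> l3; apply: DeriveDef; [exact: g3|rewrite derive1nS derive1E].
split; first by move=> x; exact: (le 0%N x).
exists (derive1n 1%N g), (derive1n 2%N g), (derive1n 3%N g).
by split => x; split; [exact: (der 0%N)|exact: (der 1%N)|exact: (der 2%N)|exact: le..].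
Qed.

Lemma jet_bound_opp (R : realType) (g : R -> R) (K : R) : jet_bound K K K g ->
  jet_bound K K K (fun x => g (- x)).
Proof.
move=> [g1 [g2 [g3 [gj gB]]]].
have dN (f : R -> R) (df x : R) : is_derive (- x) 1 f df -> is_derive x 1 (fun x => f (- x)) (- 1 * df).
  move=> fd; have H := @is_derive1_comp _ f -%R x _ _ fd (is_deriveNid x 1).
  by apply: (is_derive_eq H); rewrite mulrC.
exists (fun x => - 1 * g1 (- x)), (fun x => - 1 * (- 1 * g2 (- x))),
  (fun x => - 1 * (- 1 * (- 1 * g3 (- x)))); split => x.
  have [d1 d2 d3] := gj (- x); split; first exact: dN.
    by apply: is_derive1Z; exact: dN.
  by do 2 apply: is_derive1Z; exact: dN.
by have [b1 b2 b3] := gB (- x); rewrite !mulN1r !normrN.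
Qed.

(** The identity persists for infinite values because [fine] commutes with negation, its default 0
    being its own opposite. *)
Lemma minmaxE (R : realType) (U W : Type) (Su : set U) (Sw : set W) (X : U -> W -> R) :
  minmax Su Sw X = - maxmin Su Sw (fun u w => - X u w).
Proof.
rewrite /minmax /maxmin -fineN; congr fine; rewrite ereal_infEN; congr (- ereal_sup _)%E.
rewrite image_comp; apply: eq_imagel => u _ /=.
by rewrite -ereal_infN image_comp.
Qed.

Lemma payoff_affine (R : realType) (d : measure_display) (T : measurableType d)
    (P : probability T R) m n (A : 'I_m -> 'I_n -> {RV P >-> R})
    (Q : 'cV[R]_m -> 'cV[R]_n -> R) (s : R) t :
  (fun u w => s * payoff Q (random_matrix A t) u w) =
  affine_payoff (signed_bilinear s) (fun u w => s * Q u w) (fun ij => A ij.1 ij.2 t).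
Proof.
apply/funext => u; apply/funext => w; rewrite /payoff /affine_payoff mulrDr; congr (_ + _).
rewrite mxE; under eq_bigr do rewrite mxE mulr_suml.
rewrite exchange_big pair_bigA mulr_sumr; apply: eq_bigr => -[i j] _ /=.
by rewrite !mxE /signed_bilinear /=; ring.
Qed.

Theorem theorem2p5 (R : realType) :
  exists C0 : R, 0 < C0 /\
  forall (m n : nat)
    (dA dB : measure_display)
    (TA : measurableType dA) (PA : probability TA R)
    (TB : measurableType dB) (PB : probability TB R)
    (A : 'I_m -> 'I_n -> {RV PA >-> R}) (B : 'I_m -> 'I_n -> {RV PB >-> R})
    (Q : 'cV[R]_m -> 'cV[R]_n -> R),
  independent_family (fun ij : 'I_m * 'I_n => A ij.1 ij.2) ->
  independent_family (fun ij : 'I_m * 'I_n => B ij.1 ij.2) ->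
  (forall (i : 'I_m) (j : 'I_n) (l : nat), (1 <= l <= 2)%N ->
    ('E_PA[fun t => (A i j t ^+ l)%R] = 'E_PB[fun t => (B i j t ^+ l)%R])%E) ->
  measurable_fun [set: (borel 'cV[R]_m * borel 'cV[R]_n)%type]
    (fun uw => Q uw.1 uw.2) ->
  forall (Lu Lw : R) (Su : set 'cV[R]_m) (Sw : set 'cV[R]_n) (g : R -> R),
  1 <= Lu -> 1 <= Lw ->
  measurable (Su : set (borel 'cV[R]_m)) ->
  measurable (Sw : set (borel 'cV[R]_n)) ->
  (forall u, Su u -> forall i, - Lu <= u i ord0 <= Lu) ->
  (forall w, Sw w -> forall j, - Lw <= w j ord0 <= Lw) ->
  C3 g ->
  let L := Lu + Lw in
  let M := moment_sum A B in
  let bound := (C0%:E * Kg g *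
    ereal_inf [set M 1%N * (L * delta)%:E + modulus Q L delta
      + (log_plus (L / delta) `^ (2 / 3) * (m + n)%:R `^ (2 / 3))%:E
        * poweR (M 3%N) (1 / 3) * (L ^+ 2)%:E
      | delta in [set delta : R | (0 < delta < 1)%R]])%E in
  (`| 'E_PA[fun t => g (maxmin Su Sw (payoff Q (random_matrix A t)))]
    - 'E_PB[fun t => g (maxmin Su Sw (payoff Q (random_matrix B t)))] |
    <= bound)%E /\
  (`| 'E_PA[fun t => g (minmax Su Sw (payoff Q (random_matrix A t)))]
    - 'E_PB[fun t => g (minmax Su Sw (payoff Q (random_matrix B t)))] |
    <= bound)%E.
Proof.
exists 43; split => // m n dA dB TA PA TB PB A B Q indA indB mAB _ Lu Lw Su Sw g Lu1 Lw1 _ _ SuL SwL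
  g3 L M bound.
have MS l : (M l = \sum_(ij : 'I_m * 'I_n)
    ('E_PA[fun t => (`|A ij.1 ij.2 t| ^+ l)%R] + 'E_PB[fun t => (`|B ij.1 ij.2 t| ^+ l)%R]))%E.
  by rewrite /M /moment_sum pair_bigA.
have cg := C3_continuous g3.
split.
  have E d (T : measurableType d) (P : probability T R) (X : 'I_m -> 'I_n -> {RV P >-> R}) t :
      payoff Q (random_matrix X t) = affine_payoff (signed_bilinear 1)
        (fun u w => 1 * Q u w) (fun ij => X ij.1 ij.2 t).
    rewrite -payoff_affine; apply/funext => u; apply/funext => w; by rewrite mul1r.
  under [X in 'E_PA[X]%E]eq_fun do rewrite E.
  under [X in 'E_PB[X]%E]eq_fun do rewrite E.
  exact: (extended_maxmin_comparison Q indA indB (fun ij => mAB ij.1 ij.2) (normr1 R) Lu1 Lw1 SuL SwL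
    cg (Kg_ge1 g) (fun K => C3_jet_bound g3) (erefl L) MS).
have E d (T : measurableType d) (P : probability T R) (X : 'I_m -> 'I_n -> {RV P >-> R}) t :
    minmax Su Sw (payoff Q (random_matrix X t)) = - maxmin Su Sw (affine_payoff (signed_bilinear (-1))
      (fun u w => -1 * Q u w) (fun ij => X ij.1 ij.2 t)).
  rewrite minmaxE -payoff_affine; congr (- maxmin _ _ _).
  by apply/funext => u; apply/funext => w; rewrite mulN1r.
under [X in 'E_PA[X]%E]eq_fun do rewrite E.
under [X in 'E_PB[X]%E]eq_fun do rewrite E.
(* The sign [s = -1] turns min-max into minus a max-min, and [x -> g (- x)] absorbs the outer minus;
   its derivatives have the same absolute bounds as those of [g]. *)
apply: (extended_maxmin_comparison (g := fun x => g (- x)) Q indA indB (fun ij => mAB ij.1 ij.2) _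
  Lu1 Lw1 SuL SwL _ (Kg_ge1 g) _ (erefl L) MS).
- by rewrite normrN1.
- by move=> x; apply: continuous_comp; [exact: opp_continuous|exact: cg].
- move=> K /(C3_jet_bound g3) [gK gj]; split; first by move=> x; exact: gK.
  exact: jet_bound_opp.
Qed.
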